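(* Let $(H,\alpha)$ be a finite-dimensional monoidal Hom-Hopf algebra over a field $k$ with antipode $S$. Then there is a monoidal Hom-Hopf algebra $\mathcal{D}(H)=H^{op}\bowtie H^{\ast}$ (the Drinfel'd double), with underlying vector space $H\otimes H^{\ast}$ (write $h\ltimes f$ for $h\otimes f$), twisting automorphism $\alpha\otimes(\alpha^{-1})^{\ast}$, unit $1_H\ltimes\varepsilon_H$, the tensor product coalgebra structure of $H^{op}$ and $H^{\ast}$, and product $$(h\ltimes f)(k\ltimes g)=\sum \alpha^{2}(k_{21})h\ltimes \langle f,S(k_{1})(\alpha^{-2}(?)k_{22})\rangle g,$$ for any $h,k\in H$ and $f,g\in H^{\ast}$.
   Context: All vector spaces, tensor products and linear maps are over a fixed field $k$; Sweedler notation $\Delta(c)=\sum c_1\otimes c_2$ is used, with $k_{21}\otimes k_{22}=\Delta(k_2)$. Monoidal Hom-algebra $(A,\alpha)$: a vector space $A$ with a linear automorphism $\alpha$, a linear multiplication $a\otimes b\mapsto ab$ and an element $1_A$ with $\alpha(a)(bc)=(ab)\alpha(c)$, $a1_A=\alpha(a)=1_Aa$, $\alpha(ab)=\alpha(a)\alpha(b)$, $\alpha(1_A)=1_A$. Monoidal Hom-coalgebra $(C,\gamma)$: a vector space $C$ with a linear automorphism $\gamma$ and linear maps $\Delta:C\to C\otimes C$, $\varepsilon:C\to k$ with $\sum\gamma^{-1}(c_1)\otimes\Delta(c_2)=\sum\Delta(c_1)\otimes\gamma^{-1}(c_2)$, $\sum c_1\varepsilon(c_2)=\sum\varepsilon(c_1)c_2=\gamma^{-1}(c)$,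 $\Delta(\gamma(c))=\sum\gamma(c_1)\otimes\gamma(c_2)$, $\varepsilon(\gamma(c))=\varepsilon(c)$. Monoidal Hom-bialgebra: $(H,\alpha)$ which is both a monoidal Hom-algebra and a monoidal Hom-coalgebra (same $\alpha$), with $\Delta$ and $\varepsilon$ multiplicative and unital (componentwise product on $H\otimes H$). Monoidal Hom-Hopf algebra: a monoidal Hom-bialgebra with a linear map $S:H\to H$ (antipode) such that $S\alpha=\alpha S$ and $\sum S(h_1)h_2=\varepsilon(h)1=\sum h_1S(h_2)$. $(H^{op},\alpha)$ is $H$ with product $h\circ k=kh$ and the same coalgebra structure; products written by juxtaposition of elements of $H$ in the claim are products in $H$. For finite-dimensional $(H,\alpha)$, the dual $(H^{\ast},(\alpha^{-1})^{\ast})$, where $(\alpha^{-1})^{\ast}(f)=f\circ\alpha^{-1}$, is a monoidal Hom-Hopf algebra with product $\langle fg,a\rangle=\sum\langle f,a_1\rangle\langle g,a_2\rangle$, unit $\varepsilon_H$, coproduct $\Delta(f)=\sum f_1\otimes f_2$ determined by $\sum\langle f_1,a\rangle\langle f_2,b\rangle=\langle f,ab\rangle$, counit $f\mapsto f(1_H)$ and antipode $S^{\ast}(f)=f\circ S$. The tensor coproduct is $\Delta(h\ltimes f)=\sum(h_1\ltimes f_1)\otimes(h_2\ltimes f_2)$, with counit $\varepsilon(h\ltimes f)=\varepsilon_H(h)f(1_H)$. The symbol $?$ denotes the argument of a functional: $\langle f,S(k_{1})(\alpha^{-2}(?)k_{22})\rangle$ is the element $a\mapsto\langle f,S(k_{1})(\alpha^{-2}(a)k_{22})\rangle$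 of $H^{\ast}$, and it is then multiplied by $g$ in $H^{\ast}$. *)

(* Defs.v *)
From HB Require Import structures.
From mathcomp Require Import all_boot all_order all_algebra.

Set Implicit Arguments.
Unset Strict Implicit.
Unset Printing Implicit Defensive.

Import GRing.Theory VectorInternalTheory.
Local Open Scope ring_scope.

(* Tensor product of two finite-dimensional spaces, in the coordinates given  *)
(* by v2r: the tensor of u and v is the matrix of products of coordinates.    *)
(* tens_lift_tensor, tens_lift_linear and tens_lift_uniq are its universal    *)
(* property, so nothing depends on the choice of coordinates.                 *)
Definition tens (k : fieldType) (U V : vectType k) : vectType k :=
  'M[k]_(dim U, dim V).

Definition tensor (k : fieldType) (U V : vectType k) (u : U) (v : V) :
    tens U V :=
  (v2r u)^T *m v2r v.

Notation "u \ox v" := (tensor u v) (at level 40, left associativity).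

Definition coord_basis (k : fieldType) (V : vectType k) (i : 'I_(dim V)) : V :=
  r2v (delta_mx 0 i).

(* For bilinear F, the linear map induced by F on the tensor product.         *)
Definition tens_lift (k : fieldType) (U V : vectType k) (W : lmodType k)
    (F : U -> V -> W) (t : tens U V) : W :=
  \sum_i \sum_j (t : 'M[k]_(dim U, dim V)) i j
     *: F (coord_basis i) (coord_basis j).

(* Sweedler notation: if t = sum u (x) v, this is the sum of the F u v; F has *)
(* to be bilinear in u and v for this to be meaningful.                       *)
Notation "\sw_ ( u , v <- t ) F" := (tens_lift (fun u v => F) t)
  (at level 41, u name, v name, t at level 60, F at level 41, right associativity,
   format "'[' \sw_ ( u ,  v  <-  t ) '/  '  F ']'").

Lemma coord_basisE (k : fieldType) (V : vectType k) (u : V) :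
  u = \sum_i v2r u 0 i *: coord_basis i.
Proof.
rewrite -[LHS]v2rK [in LHS](row_sum_delta (v2r u)) linear_sum /=.
by apply: eq_bigr => i _; rewrite linearZ.
Qed.

Lemma tensor_bilinear (k : fieldType) (U V : vectType k) :
  bilinear_for *:%R *:%R (@tensor k U V).
Proof.
split=> [v|u] a x y; rewrite /tensor.
  by rewrite !linearP /= mulmxDl -scalemxAl.
by rewrite linearP /= mulmxDr -scalemxAr.
Qed.

Lemma tens_lift_linear (k : fieldType) (U V : vectType k) (W : lmodType k)
  (F : U -> V -> W) : linear (tens_lift F).
Proof.
move=> a s t; rewrite /tens_lift scaler_sumr -big_split; apply: eq_bigr => i _.
rewrite /= scaler_sumr -big_split; apply: eq_bigr => j _ /=.
by rewrite !mxE scalerDl scalerA.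
Qed.

Lemma tens_lift_tensor (k : fieldType) (U V : vectType k) (W : lmodType k)
    (F : U -> V -> W) (u : U) (v : V) :
  bilinear_for *:%R *:%R F -> \sw_(x, y <- u \ox v) F x y = F u v.
Proof.
case=> Fl Fr.
pose h := GRing.isLinear.Build k U W *:%R (F^~ v) (Fl v).
pose FL : {linear U -> W} := HB.pack (F^~ v) h.
have -> : F u v = FL u by [].
rewrite [in RHS](coord_basisE u) linear_sum /tens_lift; apply: eq_bigr => i _.
rewrite linearZ /=.
pose g := GRing.isLinear.Build k V W *:%R (F (coord_basis i))
  (Fr (coord_basis i)).
pose FR : {linear V -> W} := HB.pack (F (coord_basis i)) g.
have -> : F (coord_basis i) v = FR v by [].
rewrite [in RHS](coord_basisE v) linear_sum scaler_sumr; apply: eq_bigr => j _.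
by rewrite linearZ /= !mxE big_ord1 !mxE scalerA.
Qed.

Lemma tensE (k : fieldType) (U V : vectType k) (t : tens U V) :
  t = \sw_(u, v <- t) u \ox v.
Proof.
rewrite /tens_lift [LHS](matrix_sum_delta (t : 'M[k]_(_, _))).
apply: eq_bigr => i _; apply: eq_bigr => j _; congr (_ *: _).
by rewrite /tensor !r2vK trmx_delta mul_delta_mx.
Qed.

Lemma tens_lift_uniq (k : fieldType) (U V : vectType k) (W : lmodType k)
    (f g : tens U V -> W) :
  linear f -> linear g -> (forall u v, f (u \ox v) = g (u \ox v)) -> f =1 g.
Proof.
move=> fL gL e t.
pose f1 : {linear tens U V -> W} :=
  HB.pack f (GRing.isLinear.Build k _ W *:%R f fL).
pose g1 : {linear tens U V -> W} :=
  HB.pack g (GRing.isLinear.Build k _ W *:%R g gL).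
change (f1 t = g1 t); rewrite (tensE t) /tens_lift !linear_sum.
apply: eq_bigr => i _; rewrite !linear_sum; apply: eq_bigr => j _.
by rewrite !linearZ /= e.
Qed.

HB.instance Definition _ (k : fieldType) (U V : vectType k) :=
  bilinear_isBilinear.Build k U V (tens U V) *:%R *:%R (@tensor k U V)
    (@tensor_bilinear k U V).

Definition dual (k : fieldType) (V : vectType k) : vectType k := 'Hom(V, k^o).

Record is_hom_algebra (k : fieldType) (A : vectType k) (alpha : 'End(A))
    (mu : 'Hom(tens A A, A)) (e : A) : Prop := {
  hom_twist_bij : bijective alpha;
  hom_mulA : forall a b c : A,
    mu (alpha a \ox mu (b \ox c)) = mu (mu (a \ox b) \ox alpha c);
  hom_mulr1 : forall a : A, mu (a \ox e) = alpha a;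
  hom_mul1r : forall a : A, mu (e \ox a) = alpha a;
  hom_twistM : forall a b : A, alpha (mu (a \ox b)) = mu (alpha a \ox alpha b);
  hom_twist1 : alpha e = e
}.

Record is_hom_coalgebra (k : fieldType) (C : vectType k) (gamma : 'End(C))
    (Delta : 'Hom(C, tens C C)) (eps : 'Hom(C, k^o)) : Prop := {
  hom_cotwist_bij : bijective gamma;
  hom_comulA : forall c : C,
    \sw_(c1, c2 <- Delta c) \sw_(c21, c22 <- Delta c2)
       (gamma^-1)%VF c1 \ox (c21 \ox c22)
    = \sw_(c1, c2 <- Delta c) \sw_(c11, c12 <- Delta c1)
       c11 \ox (c12 \ox (gamma^-1)%VF c2);
  hom_counitr : forall c : C,
    \sw_(c1, c2 <- Delta c) (eps c2 *: c1) = (gamma^-1)%VF c;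
  hom_counitl : forall c : C,
    \sw_(c1, c2 <- Delta c) (eps c1 *: c2) = (gamma^-1)%VF c;
  hom_cotwist_comul : forall c : C,
    Delta (gamma c) = \sw_(c1, c2 <- Delta c) gamma c1 \ox gamma c2;
  hom_cotwist_counit : forall c : C, eps (gamma c) = eps c
}.

Record is_hom_bialgebra (k : fieldType) (H : vectType k) (alpha : 'End(H))
    (mu : 'Hom(tens H H, H)) (e : H) (Delta : 'Hom(H, tens H H))
    (eps : 'Hom(H, k^o)) : Prop := {
  hom_bialgebra_algebra : is_hom_algebra alpha mu e;
  hom_bialgebra_coalgebra : is_hom_coalgebra alpha Delta eps;
  hom_comulM : forall a b : H,
    Delta (mu (a \ox b))
    = \sw_(a1, a2 <- Delta a) \sw_(b1, b2 <- Delta b)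
       mu (a1 \ox b1) \ox mu (a2 \ox b2);
  hom_comul1 : Delta e = e \ox e;
  hom_counitM : forall a b : H, eps (mu (a \ox b)) = eps a * eps b;
  hom_counit1 : eps e = 1
}.

Record is_hom_antipode (k : fieldType) (H : vectType k) (alpha : 'End(H))
    (mu : 'Hom(tens H H, H)) (e : H) (Delta : 'Hom(H, tens H H))
    (eps : 'Hom(H, k^o)) (S : 'End(H)) : Prop := {
  hom_antipode_twist : forall h : H, S (alpha h) = alpha (S h);
  hom_antipodel : forall h : H,
    \sw_(h1, h2 <- Delta h) mu (S h1 \ox h2) = eps h *: e;
  hom_antipoder : forall h : H,
    \sw_(h1, h2 <- Delta h) mu (h1 \ox S h2) = eps h *: e
}.

Record homHopfAlgebra (k : fieldType) (H : vectType k) := HomHopfAlgebra {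
  htwist : 'End(H);
  hmul : 'Hom(tens H H, H);
  hone : H;
  hcomul : 'Hom(H, tens H H);
  hcounit : 'Hom(H, k^o);
  hantipode : 'End(H);
  homHopf_bialgebra : is_hom_bialgebra htwist hmul hone hcomul hcounit;
  homHopf_antipode : is_hom_antipode htwist hmul hone hcomul hcounit hantipode
}.

Notation "a *[ A ] b" := (hmul A (a \ox b))
  (at level 40, left associativity, format "a  *[ A ]  b").

(* The operations of the dual Hom-Hopf algebra, with unit hcounit A and       *)
(* counit f |-> f (hone A).                                                   *)
Definition dual_twist (k : fieldType) (H : vectType k) (A : homHopfAlgebra H)
    (f : dual H) : dual H :=
  (f \o (htwist A)^-1)%VF.

Definition dual_mul (k : fieldType) (H : vectType k) (A : homHopfAlgebra H)
    (f g : dual H) : dual H :=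
  linfun (fun a : H => \sw_(a1, a2 <- hcomul A a) (f a1 * g a2)).

Definition coord_form (k : fieldType) (V : vectType k) (i : 'I_(dim V)) :
    dual V :=
  linfun (fun v : V => v2r v 0 i : k^o).

(* See dual_comulP for the defining property. *)
Definition dual_comul (k : fieldType) (H : vectType k) (A : homHopfAlgebra H)
    (f : dual H) : tens (dual H) (dual H) :=
  \sum_i \sum_j
    f (coord_basis i *[A] coord_basis j) *: (coord_form i \ox coord_form j).

(* The functional a |-> <f, S(x) (alpha^-2(a) y)>. *)
Definition double_twisted (k : fieldType) (H : vectType k)
    (A : homHopfAlgebra H) (f : dual H) (x y : H) : dual H :=
  linfun (fun a : H =>
    f (hantipode A x *[A] ((htwist A)^-1%VF ((htwist A)^-1%VF a) *[A] y))).

Lemma linfunE (k : fieldType) (U V : vectType k) (F : U -> V) :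
  linear F -> linfun F =1 F.
Proof.
move=> FL u.
pose F1 : {linear U -> V} :=
  HB.pack F (GRing.isLinear.Build k U V *:%R F FL).
exact: (lfunE F1).
Qed.

Lemma dual_twistE (k : fieldType) (H : vectType k) (A : homHopfAlgebra H)
    (f : dual H) (a : H) :
  dual_twist A f a = f ((htwist A)^-1%VF a).
Proof. exact: comp_lfunE. Qed.

Lemma dual_mulE (k : fieldType) (H : vectType k) (A : homHopfAlgebra H)
    (f g : dual H) (a : H) :
  dual_mul A f g a = \sw_(a1, a2 <- hcomul A a) (f a1 * g a2).
Proof.
by rewrite linfunE // => c x y; rewrite linearP /= tens_lift_linear.
Qed.

Lemma double_twistedE (k : fieldType) (H : vectType k) (A : homHopfAlgebra H)
    (f : dual H) (x y a : H) :
  double_twisted A f x y a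
  = f (hantipode A x *[A] ((htwist A)^-1%VF ((htwist A)^-1%VF a) *[A] y)).
Proof.
rewrite linfunE // => c u v.
by rewrite !linearP /= linearPl !linearP /= linearPr !linearP.
Qed.

Lemma coord_formE (k : fieldType) (V : vectType k) (i : 'I_(dim V)) (v : V) :
  coord_form i v = v2r v 0 i.
Proof. by rewrite linfunE // => c x y; rewrite linearP !mxE. Qed.

Lemma dual_basisE (k : fieldType) (V : vectType k) (f : dual V) :
  f = \sum_i f (coord_basis i) *: coord_form i.
Proof.
apply/lfunP => v; rewrite sum_lfunE [in LHS](coord_basisE v) linear_sum.
apply: eq_bigr => i _; rewrite linearZ scale_lfunE coord_formE; exact: mulrC.
Qed.

Lemma dual_pair_bilinear (k : fieldType) (V : vectType k) (a b : V) :
  bilinear_for *:%R *:%R (fun f g : dual V => f a * g b : k^o).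
Proof.
split=> [g|f] c x y; rewrite add_lfunE scale_lfunE.
  by rewrite mulrDl -scalerAl.
by rewrite mulrDr -scalerAr.
Qed.

(* If t = sum f (x) g, this is the sum of the <f, a> <g, b>. *)
Definition dual_pair (k : fieldType) (V : vectType k)
    (t : tens (dual V) (dual V)) (a b : V) : k^o :=
  tens_lift (fun f g : dual V => f a * g b : k^o) t.

Lemma dual_tensE (k : fieldType) (V : vectType k) (t : tens (dual V) (dual V)) :
  t = \sum_i \sum_j
        dual_pair t (coord_basis i) (coord_basis j)
          *: (coord_form i \ox coord_form j).
Proof.
move: t; apply: tens_lift_uniq => [//|c s t|f g].
  rewrite scaler_sumr -big_split; apply: eq_bigr => i _.
  rewrite /= scaler_sumr -big_split; apply: eq_bigr => j _ /=.
  by rewrite /dual_pair tens_lift_linear scalerDl scalerA.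
rewrite [in LHS](dual_basisE f) linear_sumlz; apply: eq_bigr => i _ /=.
rewrite [in LHS](dual_basisE g) linear_sumr; apply: eq_bigr => j _ /=.
rewrite /dual_pair tens_lift_tensor; last exact: dual_pair_bilinear.
by rewrite linearZl_LR linearZr_LR /= scalerA.
Qed.

Lemma dual_comulP (k : fieldType) (H : vectType k) (A : homHopfAlgebra H)
    (f : dual H) (t : tens (dual H) (dual H)) :
  (forall a b : H, dual_pair t a b = f (a *[A] b))
  <-> t = dual_comul A f.
Proof.
split=> [tP|-> a b].
  rewrite [LHS]dual_tensE; apply: eq_bigr => i _; apply: eq_bigr => j _.
  by rewrite tP.
pose ev := tens_lift (fun f1 f2 : dual H => f1 a * f2 b : k^o).
pose evL : {linear tens (dual H) (dual H) -> k^o} :=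
  HB.pack ev (GRing.isLinear.Build k _ k^o *:%R ev (tens_lift_linear _)).
change (evL (dual_comul A f) = f (a *[A] b)).
rewrite [in RHS](coord_basisE a) [in RHS]linear_sumlz !linear_sum.
apply: eq_bigr => i _; rewrite [in RHS](coord_basisE b) linear_sumr !linear_sum.
apply: eq_bigr => j _; rewrite linearZ.
have -> : evL (coord_form i \ox coord_form j)
          = coord_form i a * coord_form j b :> k^o.
  exact: (tens_lift_tensor _ _ (dual_pair_bilinear a b)).
rewrite linearZl_LR linearZr_LR !linearZ /= !coord_formE scalerA.
exact: mulrC.
Qed.

(* Main.v *)
From HB Require Import structures.
From mathcomp Require Import all_boot all_order all_algebra.
Require Import Defs.

(** Writing [a b = alpha (a . b)] and [Delta = (alpha^-1 (x) alpha^-1) o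
    Delta'] turns the monoidal Hom-Hopf algebra [H] into an ordinary Hopf
    algebra with product [.] and coproduct [Delta'], on which [alpha] acts by
    Hopf automorphisms, and every Hopf algebra with an automorphism arises in
    this way. The stated product is the twist of the product [(h, f) (k, g) =
    sum (k_2 . h, f(S k_1 . ? . k_3) g)] of the ordinary double, so it is
    enough to construct the latter and to check that [alpha (x) (alpha^-1)^*]
    is an automorphism of it.

    A coalgebra is spanned by coefficients [T i j] with [Delta' (T i j) =
    sum_e T i e (x) T e j] and [eps (T i j) = delta_ij]. On these, Sweedler
    sums become sums over indices, coassociativity is an exchange of sums, and
    the antipode axiom says that [S T] is the inverse of the matrix [T].

    The antipode of the double is [(h, f) |-> (1, f o S) (S^-1 h, 1)], so [S]
    has to be bijective. Let [f] be an even power of [S] with [im f = im f^2]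
    and [f] injective on [im f], and choose a matrix [P] over [im f] with [f P
    = f T]. Applying [f] shows that [S P] is inverse to [P], as [S T] is to
    [T]. As [S^n P] is the inverse of [S^(n+1) P], in [H] or in the opposite
    algebra, [S^(n+1) P = S^(n+1) T] implies [S^n P = S^n T]. Descending from
    [f P = f T] gives [P = T], so [f] is onto. *)

Set Implicit Arguments.
Unset Strict Implicit.
Unset Printing Implicit Defensive.

Import GRing.Theory VectorInternalTheory.
Local Open Scope ring_scope.

(* [linear] under a constant, so that [apply:] does not see its quantifiers.  *)
Definition islin (k : fieldType) (U V : lmodType k) (F : U -> V) : Prop :=
  linear F.

(** * Linear maps and sums over tensors *)

Section IsLin.
Variables (k : fieldType).
Implicit Types U V W : vectType k.

Lemma islin_id (U : lmodType k) : islin (fun x : U => x).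
Proof. by []. Qed.

Lemma islin_lfun U V W (g : 'Hom(V, W)) (F : U -> V) :
  islin F -> islin (fun x => g (F x)).
Proof. by move=> FL a x y; rewrite FL linearP. Qed.

Lemma islin_eval U V W (F : U -> 'Hom(V, W)) v :
  islin F -> islin (fun x => F x v).
Proof. by move=> FL a x y; rewrite FL add_lfunE scale_lfunE. Qed.

Lemma islin_sum U V (I : Type) (r : seq I) (P : pred I) (F : I -> U -> V) :
  (forall i, islin (F i)) -> islin (fun x => \sum_(i <- r | P i) F i x).
Proof.
move=> FL a x y; rewrite scaler_sumr -big_split; apply: eq_bigr => i _.
exact: FL.
Qed.

Lemma islin_scaler U V a (F : U -> V) : islin F -> islin (fun x => a *: F x).
Proof. by move=> FL b x y; rewrite FL scalerDr !scalerA mulrC. Qed.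

Lemma islin_scalel U V (F : U -> k^o) (v : V) :
  islin F -> islin (fun x => F x *: v).
Proof. by move=> FL b x y; rewrite FL scalerDl scalerA. Qed.

Lemma islin_mull U (F : U -> k^o) (a : k) :
  islin F -> islin (fun x => F x * a : k^o).
Proof. by move=> FL b x y; rewrite FL mulrDl -scalerAl. Qed.

Lemma islin_mulr U (F : U -> k^o) (a : k) :
  islin F -> islin (fun x => a * F x : k^o).
Proof. by move=> FL b x y; rewrite FL mulrDr; congr (_ + _); apply: mulrCA. Qed.

Lemma islin_tensl U V W (F : U -> V) (w : W) :
  islin F -> islin (fun x => F x \ox w).
Proof. by move=> FL b x y; rewrite FL linearPl. Qed.

Lemma islin_tensr U V W (F : U -> V) (w : W) :
  islin F -> islin (fun x => w \ox F x).
Proof. by move=> FL b x y; rewrite FL linearPr. Qed.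

Lemma islin_sw U V W (X : vectType k) (F : V -> W -> X) (t : U -> tens V W) :
  islin t -> islin (fun x => \sw_(u, v <- t x) F u v).
Proof. by move=> tL b x y; rewrite tL tens_lift_linear. Qed.

Lemma islin_swF U V W (X : vectType k) (F : U -> V -> W -> X) (t : tens V W) :
  (forall u v, islin (fun x => F x u v)) ->
  islin (fun x => \sw_(u, v <- t) F x u v).
Proof.
move=> FL; apply: islin_sum => i; apply: islin_sum => j.
by apply: islin_scaler; apply: FL.
Qed.

Section Use.
Variables (U V : lmodType k) (F : U -> V).
Hypothesis FL : islin F.
Let Fl : {linear U -> V} := HB.pack F (GRing.isLinear.Build k U V *:%R F FL).

Lemma islinZ a x : F (a *: x) = a *: F x.
Proof. by rewrite -[F]/(Fl : U -> V) linearZ. Qed.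

Lemma islin_bigsum (I : Type) (r : seq I) (P : pred I) (G : I -> U) :
  F (\sum_(i <- r | P i) G i) = \sum_(i <- r | P i) F (G i).
Proof. exact: (linear_sum Fl). Qed.

End Use.

Lemma sw_tensor U V W (F : U -> V -> W) u v :
  (forall v, islin (F^~ v)) -> (forall u, islin (F u)) ->
  \sw_(x, y <- u \ox v) F x y = F u v.
Proof. by move=> Fl Fr; apply: tens_lift_tensor. Qed.

Lemma sw_sum U V W (F : U -> V -> W) (I : Type) (r : seq I) (u : I -> U)
    (v : I -> V) :
  (forall v, islin (F^~ v)) -> (forall u, islin (F u)) ->
  \sw_(x, y <- \sum_(i <- r) u i \ox v i) F x y = \sum_(i <- r) F (u i) (v i).
Proof.
move=> Fl Fr; rewrite (islin_bigsum (@tens_lift_linear k U V W F)).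
by apply: eq_bigr => i _; apply: sw_tensor.
Qed.

Lemma eq_sw U V W (F G : U -> V -> W) t :
  (forall u v, F u v = G u v) -> \sw_(x, y <- t) F x y = \sw_(x, y <- t) G x y.
Proof.
by move=> FG; apply: eq_bigr => i _; apply: eq_bigr => j _; rewrite FG.
Qed.

Lemma tens_ext U V W (f g : tens U V -> W) :
  islin f -> islin g -> (forall u v, f (u \ox v) = g (u \ox v)) ->
  forall t, f t = g t.
Proof. by move=> fL gL fg; apply: tens_lift_uniq. Qed.

Lemma dual_tens_ext V (s t : tens (dual V) (dual V)) :
  (forall a b, dual_pair s a b = dual_pair t a b) -> s = t.
Proof.
move=> st; rewrite [s]dual_tensE [t]dual_tensE.
by apply: eq_bigr => i _; apply: eq_bigr => j _; rewrite st.
Qed.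

Lemma dual_pair_sum V (I : Type) (r : seq I) (f g : I -> dual V) a b :
  dual_pair (\sum_(i <- r) f i \ox g i) a b = \sum_(i <- r) f i a * g i b.
Proof.
by apply: sw_sum => f0; [apply: islin_mull | apply: islin_mulr];
  apply: islin_eval; apply: islin_id.
Qed.

Lemma sum_deltal (V : lmodType k) (I : finType) (i : I) (F : I -> V) :
  \sum_e (i == e)%:R *: F e = F i.
Proof.
rewrite (bigD1 i) //= eqxx scale1r big1 ?addr0 // => e.
by rewrite eq_sym => /negPf ->; rewrite scale0r.
Qed.

Lemma sum_deltar (V : lmodType k) (I : finType) (i : I) (F : I -> V) :
  \sum_e (e == i)%:R *: F e = F i.
Proof.
by rewrite -[RHS]sum_deltal; apply: eq_bigr => e _; rewrite eq_sym.
Qed.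

End IsLin.

Ltac islin_step := first
  [ exact: islin_id
  | apply: islin_lfun | apply: islin_tensl | apply: islin_tensr
  | apply: islin_sw | apply: islin_swF => ? ?
  | apply: islin_scalel | apply: islin_scaler
  | apply: islin_mull | apply: islin_mulr
  | apply: islin_eval | apply: islin_sum => ? ].

Lemma sw_lin (k : fieldType) (U V W X : vectType k) (P : W -> X)
    (F : U -> V -> W) t :
  islin P -> P (\sw_(u, v <- t) F u v) = \sw_(u, v <- t) P (F u v).
Proof.
move=> PL; rewrite (islin_bigsum PL); apply: eq_bigr => i _.
by rewrite (islin_bigsum PL); apply: eq_bigr => j _; rewrite (islinZ PL).
Qed.

Lemma sw_bigsum (k : fieldType) (U V W : vectType k) (I : Type) (r : seq I)
    (F : I -> U -> V -> W) t :
  \sw_(u, v <- t) (\sum_(i <- r) F i u v)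
  = \sum_(i <- r) \sw_(u, v <- t) F i u v.
Proof.
rewrite /tens_lift [RHS]exchange_big; apply: eq_bigr => a _.
rewrite [RHS]exchange_big; apply: eq_bigr => b _; exact: scaler_sumr.
Qed.

(** The entries of the matrix representing a tensor are its pairings with products of coordinate
    forms, so pure functionals separate tensors. This allows an identity about a coproduct to be
    tested in the dual algebra. *)
Lemma tens_dual_ext (k : fieldType) (U V : vectType k) (s t : tens U V) :
  (forall (f : dual U) (g : dual V),
     \sw_(u, v <- s) (f u * g v : k^o) = \sw_(u, v <- t) (f u * g v : k^o)) ->
  s = t.
Proof.
have entryE (z : tens U V) i j : (z : 'M_(_, _)) i j
    = \sw_(u, v <- z) (coord_form i u * coord_form j v : k^o).
  move: z; apply: (@tens_ext k U V k^o (fun z => (z : 'M_(_, _)) i j))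
    => [a x y||u v].
  - by rewrite !mxE.
  - by repeat islin_step.
  rewrite sw_tensor; try by move=> ?; repeat islin_step.
  by rewrite !mxE big_ord1 !mxE !coord_formE.
by move=> st; apply/matrixP => i j; rewrite [LHS]entryE [RHS]entryE st.
Qed.

(** * Hopf algebras spanned by matrix coefficients *)

(* Coassociativity and the counit axioms are not listed: they follow from the *)
(* formulas for the coproduct and the counit of the spanning elements.        *)
Record hopf (k : fieldType) (H : vectType k) := Hopf {
  hopf_mul : H -> H -> H;
  hopf_one : H;
  hopf_comul : 'Hom(H, tens H H);
  hopf_counit : 'Hom(H, k^o);
  hopf_antipode : 'End(H);
  hopf_index : finType;
  hopf_coef : hopf_index -> hopf_index -> H;
  hopf_mul_bilinear : bilinear_for *:%R *:%R hopf_mul;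
  hopf_mulA : associative hopf_mul;
  hopf_mul1l : left_id hopf_one hopf_mul;
  hopf_mul1r : right_id hopf_one hopf_mul;
  hopf_coef_span : forall c, exists a : hopf_index -> hopf_index -> k,
    c = \sum_i \sum_j a i j *: hopf_coef i j;
  hopf_comul_coef : forall i j,
    hopf_comul (hopf_coef i j) = \sum_e hopf_coef i e \ox hopf_coef e j;
  hopf_counit_coef : forall i j, hopf_counit (hopf_coef i j) = (i == j)%:R;
  hopf_comulM : forall i j l m,
    hopf_comul (hopf_mul (hopf_coef i j) (hopf_coef l m))
    = \sum_e \sum_f hopf_mul (hopf_coef i e) (hopf_coef l f)
                      \ox hopf_mul (hopf_coef e j) (hopf_coef f m);
  hopf_comul1 : hopf_comul hopf_one = hopf_one \ox hopf_one;
  hopf_counitM : forall x y,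
    hopf_counit (hopf_mul x y) = hopf_counit x * hopf_counit y;
  hopf_counit1 : hopf_counit hopf_one = 1;
  hopf_antipodel : forall i j,
    \sum_e hopf_mul (hopf_antipode (hopf_coef i e)) (hopf_coef e j)
    = (i == j)%:R *: hopf_one;
  hopf_antipoder : forall i j,
    \sum_e hopf_mul (hopf_coef i e) (hopf_antipode (hopf_coef e j))
    = (i == j)%:R *: hopf_one
}.

HB.instance Definition _ (k : fieldType) (H : vectType k) (B : hopf H) :=
  bilinear_isBilinear.Build k H H H *:%R *:%R (hopf_mul B)
    (hopf_mul_bilinear B).

Lemma islin_hmull (k : fieldType) (U H : vectType k) (B : hopf H)
    (F : U -> H) (c : H) :
  islin F -> islin (fun x => hopf_mul B (F x) c).
Proof. by move=> FL a x y; rewrite FL linearPl. Qed.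

Lemma islin_hmulr (k : fieldType) (U H : vectType k) (B : hopf H)
    (F : U -> H) (c : H) :
  islin F -> islin (fun x => hopf_mul B c (F x)).
Proof. by move=> FL a x y; rewrite FL linearPr. Qed.

Ltac islin_hopf :=
  first [ islin_step | apply: islin_hmull | apply: islin_hmulr ].

(** A left and a right inverse of [W] agree by associativity. The product is a parameter so that the
    opposite product can be used as well. *)
Lemma matrix_inverse_uniq (k : fieldType) (H : vectType k) (op : H -> H -> H)
    (one : H) (J : finType) (X W Y : J -> J -> H) :
  bilinear_for *:%R *:%R op -> associative op ->
  left_id one op -> right_id one op ->
  (forall i j, \sum_e op (X i e) (W e j) = (i == j)%:R *: one) ->
  (forall i j, \sum_e op (W i e) (Y e j) = (i == j)%:R *: one) ->
  forall i j, X i j = Y i j.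
Proof.
move=> [opl opr] opA op1l op1r XW WY i j.
have sl c := islin_bigsum (opl c); have sr c := islin_bigsum (opr c).
have zl c := islinZ (opl c); have zr c := islinZ (opr c).
transitivity (\sum_e \sum_f op (op (X i e) (W e f)) (Y f j)).
  rewrite -[LHS](sum_deltar j (X i)); apply: eq_bigr => e _.
  rewrite -[X in _ *: X]op1r -zr -WY sr; apply: eq_bigr => f _.
  exact: opA.
rewrite exchange_big /= -[RHS](sum_deltal i (Y^~ j)); apply: eq_bigr => f _.
by rewrite -sl XW zl op1l.
Qed.

Section Hopf.
Variables (k : fieldType) (H : vectType k) (B : hopf H).
Local Notation "x ** y" := (hopf_mul B x y) (at level 40, left associativity).
Local Notation "1h" := (hopf_one B).
Local Notation De := (hopf_comul B).
Local Notation ep := (hopf_counit B).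
Local Notation S := (hopf_antipode B).
Local Notation I := (hopf_index B).
Local Notation T := (@hopf_coef k H B).

Lemma coef_ext (W : vectType k) (P Q : H -> W) :
  islin P -> islin Q -> (forall i j, P (T i j) = Q (T i j)) ->
  forall c, P c = Q c.
Proof.
move=> PL QL PQ c; have [a ->] := hopf_coef_span B c.
rewrite (islin_bigsum PL) (islin_bigsum QL); apply: eq_bigr => i _.
rewrite (islin_bigsum PL) (islin_bigsum QL); apply: eq_bigr => j _.
by rewrite (islinZ PL) (islinZ QL) PQ.
Qed.

(** These are the coefficient matrices of comodules of any finite dimension. Products, transposed
    antipodes and automorphic images of the [T i j] need not be among the [T i j], but they form
    comatrices again, so Sweedler sums over them are still index sums. *)
Definition comatrix (J : finType) (M : J -> J -> H) : Prop :=
  (forall i j, De (M i j) = \sum_e M i e \ox M e j)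
  /\ (forall i j, ep (M i j) = (i == j)%:R).

Lemma coef_comatrix : comatrix T.
Proof. by split; [exact: hopf_comul_coef | exact: hopf_counit_coef]. Qed.

Lemma sw_comatrix (J : finType) (M : J -> J -> H) (W : vectType k)
    (F : H -> H -> W) i j :
  comatrix M -> (forall v, islin (F^~ v)) -> (forall u, islin (F u)) ->
  \sw_(x, y <- De (M i j)) F x y = \sum_e F (M i e) (M e j).
Proof. by case=> dM _ Fl Fr; rewrite dM sw_sum. Qed.

Lemma comul_mul x y :
  De (x ** y) = \sw_(x1, x2 <- De x) \sw_(y1, y2 <- De y)
                  (x1 ** y1) \ox (x2 ** y2).
Proof.
move: x; apply: coef_ext => [||i j]; [by repeat islin_hopf..|].
move: y; apply: coef_ext => [||l m]; [by repeat islin_hopf..|].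
rewrite sw_comatrix; [|exact: coef_comatrix|by move=> v; repeat islin_hopf..].
rewrite hopf_comulM; apply: eq_bigr => e _.
by rewrite sw_comatrix;
  [|exact: coef_comatrix|by move=> v; repeat islin_hopf..].
Qed.

(** This Kronecker product is the coefficient matrix of the tensor product of two comodules. *)
Lemma comatrix_mul (J K : finType) (M : J -> J -> H) (N : K -> K -> H) :
  comatrix M -> comatrix N ->
  comatrix (fun p q : J * K => M p.1 q.1 ** N p.2 q.2).
Proof.
move=> cM cN; split=> p q.
  rewrite comul_mul sw_comatrix //; try by move=> v; repeat islin_hopf.
  rewrite -(pair_bigA _ (fun e f => (M p.1 e ** N p.2 f)
     \ox (M e q.1 ** N f q.2))); apply: eq_bigr => e _ /=.
  by rewrite sw_comatrix //; move=> v; repeat islin_hopf.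
by rewrite hopf_counitM (proj2 cM) (proj2 cN) -natrM mulnb.
Qed.

(** The trivial comodule; it lets formulas stated for coefficients be evaluated at the unit. *)
Lemma comatrix1 : comatrix (fun _ _ : 'I_1 => 1h).
Proof.
split=> i j; first by rewrite big_ord1 hopf_comul1.
by rewrite hopf_counit1 !ord1 eqxx.
Qed.

Lemma sw_antipodel c : \sw_(x, y <- De c) (S x ** y) = ep c *: 1h.
Proof.
move: c; apply: coef_ext => [||i j]; [by repeat islin_hopf..|].
rewrite sw_comatrix; [|exact: coef_comatrix|by move=> v; repeat islin_hopf..].
by rewrite hopf_antipodel hopf_counit_coef.
Qed.

Lemma sw_antipoder c : \sw_(x, y <- De c) (x ** S y) = ep c *: 1h.
Proof.
move: c; apply: coef_ext => [||i j]; [by repeat islin_hopf..|].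
rewrite sw_comatrix; [|exact: coef_comatrix|by move=> v; repeat islin_hopf..].
by rewrite hopf_antipoder hopf_counit_coef.
Qed.

Lemma comatrix_antipodel (J : finType) (M : J -> J -> H) i j :
  comatrix M -> \sum_e S (M i e) ** M e j = (i == j)%:R *: 1h.
Proof.
move=> cM; rewrite -(proj2 cM) -sw_antipodel sw_comatrix //;
  by move=> v; repeat islin_hopf.
Qed.

Lemma antipode1 : S 1h = 1h.
Proof.
have := comatrix_antipodel ord0 ord0 comatrix1.
by rewrite big_ord1 eqxx scale1r hopf_mul1r.
Qed.

(** Let [W] be the Kronecker product of [T] with itself. It is a comatrix, so [S W] is a left
    inverse of it, while the reversed product of antipodes is a right inverse: the sum over the
    second index collapses first, then the sum over the first. *)
Lemma antipodeM x y : S (x ** y) = S y ** S x.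
Proof.
move: x; apply: coef_ext => [||i j]; [by repeat islin_hopf..|].
move: y; apply: coef_ext => [||l m]; [by repeat islin_hopf..|].
pose W (p q : I * I) := T p.1 q.1 ** T p.2 q.2.
pose X p q := S (W p q).
pose Y (p q : I * I) := S (T p.2 q.2) ** S (T p.1 q.1).
rewrite -[LHS]/(X (i, l) (j, m)) -[RHS]/(Y (i, l) (j, m)).
apply: (@matrix_inverse_uniq k H (hopf_mul B) 1h _ X W Y).
- exact: hopf_mul_bilinear.
- exact: hopf_mulA.
- exact: hopf_mul1l.
- exact: hopf_mul1r.
- move=> p q; apply: comatrix_antipodel.
  by apply: comatrix_mul; apply: coef_comatrix.
move=> p q; rewrite -(pair_bigA _ (fun e f =>
  (T p.1 e ** T p.2 f) ** (S (T f q.2) ** S (T e q.1)))) /=.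
under eq_bigr => e _.
  under eq_bigr => f _ do
    rewrite hopf_mulA -[_ ** T p.2 f ** _]hopf_mulA.
  rewrite -linear_sumlz -linear_sumr hopf_antipoder.
  rewrite linearZr_LR linearZl_LR /= hopf_mul1r.
  over.
by rewrite -scaler_sumr hopf_antipoder scalerA -natrM mulnb andbC.
Qed.

End Hopf.

(** * Bijectivity of the antipode *)

(** As long as the image of [f \o f] is smaller than that of [f], squaring lowers the rank, so the
    images become stable. By rank and nullity the kernels of [f] and [f \o f] then agree too. The
    exponent is positive, so that injectivity of [f] passes to [g]. *)
Lemma fitting_iter (k : fieldType) (V : vectType k) (g : 'End(V)) :
  exists n (f : 'End(V)), [/\ f =1 iter n.+1 g,
    (limg f <= limg (f \o f))%VS & forall u, f (f u) = 0 -> f u = 0].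
Proof.
pose P (f : 'End(V)) := exists n, f =1 iter n.+1 g.
suff: forall d f, P f -> (\dim (limg f) <= d)%N ->
    exists f', P f' /\ (limg f' <= limg (f' \o f'))%VS.
  have Pg : P g by exists 0%N.
  case/(_ _ g Pg (leqnn _)) => f [[n fE] fs]; exists n, f; split=> // u fu0.
  have imE : limg (f \o f) = limg f.
    by apply/eqP; rewrite eqEsubv fs limg_comp limgS ?subvf.
  have kerE : lker f = lker (f \o f).
    apply/eqP; rewrite eqEdim; apply/andP; split.
      by apply/subvP => v; rewrite !memv_ker comp_lfunE => /eqP ->;
        rewrite linear0.
    have := limg_ker_dim f fullv; have := limg_ker_dim (f \o f)%VF fullv.
    rewrite imE !capfv => <- /eqP; rewrite eqn_add2r => /eqP ->.
    exact: leqnn.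
  by apply/eqP; rewrite -memv_ker kerE memv_ker comp_lfunE fu0.
elim=> [|d IHd] f Pf fd.
  exists f; split=> //; move: fd; rewrite leqn0 dimv_eq0 => /eqP ->.
  exact: sub0v.
have [fs|fs] := boolP (limg f <= limg (f \o f))%VS; first by exists f.
apply: (IHd (f \o f)%VF).
  case: Pf => n fE; exists (n.+1 + n)%N => u.
  by rewrite comp_lfunE !fE -addnS iterD.
have fs' : (limg (f \o f) <= limg f)%VS by rewrite limg_comp limgS ?subvf.
rewrite -ltnS; apply: leq_trans fd; rewrite ltnNge; apply: contra fs => fs.
by have := eqEdim (limg (f \o f)) (limg f); rewrite fs' fs => /eqP ->.
Qed.

Section AntipodeBijective.
Variables (k : fieldType) (H : vectType k) (B : hopf H).
Local Notation "x ** y" := (hopf_mul B x y) (at level 40, left associativity).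
Local Notation "1h" := (hopf_one B).
Local Notation S := (hopf_antipode B).
Local Notation I := (hopf_index B).
Local Notation T := (@hopf_coef k H B).

(* S^n is multiplicative from the product of H to opm n.                      *)
Let opm (n : nat) (x y : H) := if odd n then y ** x else x ** y.

Let opmS n x y : S (opm n x y) = opm n.+1 (S x) (S y).
Proof. by rewrite /opm /=; case: odd; rewrite antipodeM. Qed.

Let opm_bilinear n : bilinear_for *:%R *:%R (opm n).
Proof.
by rewrite /opm; case: odd; split=> c; [move: c| |move: c|];
  repeat islin_hopf; move=> c; repeat islin_hopf.
Qed.

Let opmA n : associative (opm n).
Proof. by rewrite /opm; case: odd => x y z; rewrite hopf_mulA. Qed.

Let opm1l n : left_id 1h (opm n).
Proof. by rewrite /opm; case: odd => x; rewrite ?hopf_mul1l ?hopf_mul1r. Qed.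

Let opm1r n : right_id 1h (opm n).
Proof. by rewrite /opm; case: odd => x; rewrite ?hopf_mul1l ?hopf_mul1r. Qed.

Let antipode_inverse (M : I -> I -> H) : Prop :=
  (forall i j, \sum_e S (M i e) ** M e j = (i == j)%:R *: 1h)
  /\ (forall i j, \sum_e M i e ** S (M e j) = (i == j)%:R *: 1h).

(** Applying [S] to the relation for [n] gives the one for [n.+1], because [S] reverses the product
    and fixes the unit. *)
Let iter_antipoder M n i j : antipode_inverse M ->
  \sum_e opm n (iter n S (M i e)) (iter n.+1 S (M e j)) = (i == j)%:R *: 1h.
Proof.
case=> _ iM; elim: n => [|n IHn]; first exact: iM.
under eq_bigr do rewrite !iterS -opmS.
by rewrite -linear_sum IHn linearZ /= antipode1.
Qed.

Let iter_antipodel M n i j : antipode_inverse M ->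
  \sum_e opm n (iter n.+1 S (M i e)) (iter n S (M e j)) = (i == j)%:R *: 1h.
Proof.
case=> iM _; elim: n => [|n IHn]; first exact: iM.
under eq_bigr do rewrite !iterS -opmS.
by rewrite -linear_sum IHn linearZ /= antipode1.
Qed.

Let descent M N n : antipode_inverse M -> antipode_inverse N ->
  (forall i j, iter n S (M i j) = iter n S (N i j)) ->
  forall i j, M i j = N i j.
Proof.
move=> iM iN; elim: n => // n IHn MN; apply: IHn => i j.
apply: (@matrix_inverse_uniq k H (opm n) 1h _ (fun i j => iter n S (M i j))
  (fun i j => iter n.+1 S (M i j)) (fun i j => iter n S (N i j))) => //.
- by move=> a b; apply: iter_antipoder.
- by move=> a b; under eq_bigr do rewrite MN; apply: iter_antipodel.
Qed.

Lemma antipode_lker0 : lker S == 0%VS.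
Proof.
(* The square of [S] preserves the order of products, so its iterate [f] is an algebra
   endomorphism. *)
have [n [f [fE fs f0]]] := fitting_iter (S \o S)%VF.
have fS u : f u = iter (n.+1 * 2) S u.
  rewrite fE; elim: (n.+1) => [|m IHm] //=.
  by rewrite IHm comp_lfunE.
have fM x y : f (x ** y) = f x ** f y.
  by rewrite !fE; elim: (n.+1) => //= m ->; rewrite !comp_lfunE !antipodeM.
have f1 : f 1h = 1h.
  by rewrite fE; elim: (n.+1) => //= m ->; rewrite comp_lfunE !antipode1.
have fSC u : f (S u) = S (f u).
  by rewrite !fS -iterSr.
have f_inj u v : f (f u) = f (f v) -> f u = f v.
  move=> /eqP; rewrite -subr_eq0 -!linearB /= => /eqP /f0.
  by rewrite linearB => /eqP; rewrite subr_eq0 => /eqP.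
(* A preimage of [f u] under [f \o f], which exists by [fs]. Thus [f (w u)] lies in the image of [f]
   and has the same image under [f] as [u]. *)
pose w u := (f \o f)^-1%VF (f u).
have fw u : f (f (w u)) = f u.
  rewrite -comp_lfunE; apply: limg_lfunVK; apply: (subvP fs).
  exact: memv_img (memvf u).
pose P i j := f (w (T i j)).
have iT : antipode_inverse T.
  by split=> i j; [apply: hopf_antipodel | apply: hopf_antipoder].
have d1 (i j : I) : (i == j)%:R *: 1h = f ((i == j)%:R *: 1h).
  by rewrite linearZ /= f1.
(* Both sides of each relation are values of [f], so by [f_inj] they may be compared after one more
   application of [f], where [fw] replaces [P] by [T]. *)
have iP : antipode_inverse P.
  split=> i j; rewrite /P.
    under eq_bigr => e _ do rewrite -fSC -fM.
    rewrite -linear_sum d1; apply: f_inj; rewrite -!d1 d1 -hopf_antipodel.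
    by rewrite !linear_sum; apply: eq_bigr => e _ /=; rewrite !fM !fSC !fw.
  under eq_bigr => e _ do rewrite -fSC -fM.
  rewrite -linear_sum d1; apply: f_inj; rewrite -!d1 d1 -hopf_antipoder.
  by rewrite !linear_sum; apply: eq_bigr => e _ /=; rewrite !fM !fSC !fw.
have PT : forall i j, P i j = T i j.
  apply: (@descent P T (n.+1 * 2)) => // i j.
  by rewrite -!fS fw.
have onto : limg f = fullv.
  apply/vspaceP => c; rewrite memvf; have [a ->] := hopf_coef_span B c.
  apply: memv_suml => i _; apply: memv_suml => j _; apply: memvZ.
  by rewrite -PT memv_img ?memvf.
have f_lker : lker f == 0%VS.
  rewrite -dimv_eq0 -(eqn_add2r (\dim (limg f))) add0n.
  by rewrite -{1}[lker f]capfv limg_ker_dim onto.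
(* Since [f] is the power of [S] with exponent [2n + 2], the remaining [2n + 1] factors are applied
   to an equality of values of [S]. *)
apply/lker0P => u v /(congr1 (iter (n.*2.+1) S)).
rewrite -!iterSr -doubleS -muln2 -!fS.
by move/lker0P: f_lker; apply.
Qed.

End AntipodeBijective.

(** * The dual Hopf algebra *)

Definition dual_precomp (k : fieldType) (H : vectType k) (g : 'End(H)) :
    'End(dual H) :=
  linfun (fun f : dual H => (f \o g)%VF).

Lemma dual_precompE (k : fieldType) (H : vectType k) (g : 'End(H))
    (f : dual H) :
  dual_precomp g f = (f \o g)%VF.
Proof.
apply: linfunE => a u v; apply/lfunP => c.
by rewrite !(comp_lfunE, add_lfunE, scale_lfunE).
Qed.

Lemma dual_precomp_eval (k : fieldType) (H : vectType k) (g : 'End(H))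
    (f : dual H) a :
  dual_precomp g f a = f (g a).
Proof. by rewrite dual_precompE comp_lfunE. Qed.

Section DualHopf.
Variables (k : fieldType) (H : vectType k) (B : hopf H).
Local Notation "x ** y" := (hopf_mul B x y) (at level 40, left associativity).
Local Notation "1h" := (hopf_one B).
Local Notation De := (hopf_comul B).
Local Notation ep := (hopf_counit B).
Local Notation S := (hopf_antipode B).
Local Notation T := (@hopf_coef k H B).

Definition convolution (f g : dual H) : dual H :=
  linfun (fun a : H => \sw_(a1, a2 <- De a) (f a1 * g a2 : k^o)).

Lemma convolutionE f g a :
  convolution f g a = \sw_(a1, a2 <- De a) (f a1 * g a2 : k^o).
Proof.
by rewrite linfunE //; apply: (@islin_sw _ H H H k^o); repeat islin_hopf.
Qed.

Lemma convolution_comatrix (J : finType) (M : J -> J -> H) f g i j :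
  comatrix B M -> convolution f g (M i j) = \sum_e f (M i e) * g (M e j).
Proof.
move=> cM; rewrite convolutionE sw_comatrix //; move=> v; repeat islin_hopf.
Qed.

Lemma dual_ext (f g : dual H) :
  (forall i j, f (T i j) = g (T i j)) -> f = g.
Proof.
by move=> fg; apply/lfunP; apply: coef_ext => //; repeat islin_hopf.
Qed.

(** The transpose of the product, read through the identification of the dual of [tens H H] with
    [tens (dual H) (dual H)]. *)
Definition multiplication_dual (f : dual H) : tens (dual H) (dual H) :=
  \sum_i \sum_j f (coord_basis i ** coord_basis j)
     *: (coord_form i \ox coord_form j).

Definition dual_hopf_comul : 'Hom(dual H, tens (dual H) (dual H)) :=
  linfun multiplication_dual.

Lemma dual_hopf_comulE f : dual_hopf_comul f = multiplication_dual f.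
Proof.
apply: linfunE; rewrite -/(islin _) /multiplication_dual.
by repeat islin_hopf.
Qed.

Lemma dual_hopf_comul_pair f a b :
  dual_pair (dual_hopf_comul f) a b = f (a ** b).
Proof.
rewrite dual_hopf_comulE [in RHS](coord_basisE a) linear_sumlz linear_sum.
rewrite /dual_pair (islin_bigsum (@tens_lift_linear k _ _ _ _)).
apply: eq_bigr => i _.
rewrite (islin_bigsum (@tens_lift_linear k _ _ _ _)).
rewrite [in RHS](coord_basisE b) linear_sumr linear_sum; apply: eq_bigr => j _.
rewrite (islinZ (@tens_lift_linear k _ _ _ _)) sw_tensor;
  try by move=> ?; repeat islin_hopf.
rewrite linearZr_LR linearZl_LR !linearZ /= !coord_formE scalerA.
exact: mulrC.
Qed.

Definition dual_hopf_counit : 'Hom(dual H, k^o) :=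
  linfun (fun f : dual H => f 1h).

Lemma dual_hopf_counitE f : dual_hopf_counit f = f 1h.
Proof. by apply: linfunE; rewrite -/(islin _); repeat islin_hopf. Qed.

Definition dual_hopf_antipode : 'End(dual H) := dual_precomp S.

Lemma dual_hopf_antipodeE f a : dual_hopf_antipode f a = f (S a).
Proof. exact: dual_precomp_eval. Qed.

(* Matrix coefficients of the left regular representation. *)
Definition regular_coef (i j : 'I_(dim H)) : dual H :=
  linfun (fun a : H => v2r (a ** coord_basis j) 0 i : k^o).

Lemma regular_coefE i j a : regular_coef i j a = v2r (a ** coord_basis j) 0 i.
Proof. by rewrite linfunE // => c x y; rewrite linearPl linearP !mxE. Qed.

(** Left multiplication by [a ** b] is a composite, so its matrix is a product of matrices. Dually,
    this is the coproduct formula required of spanning coefficients. *)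
Lemma regular_coefM i j a b :
  regular_coef i j (a ** b) = \sum_e regular_coef i e a * regular_coef e j b.
Proof.
rewrite regular_coefE -hopf_mulA [b ** _](coord_basisE) linear_sumr linear_sum.
rewrite summxE; apply: eq_bigr => e _.
by rewrite linearZr_LR linearZ mxE -!regular_coefE mulrC.
Qed.

Lemma regular_coef1 i j : regular_coef i j 1h = (i == j)%:R.
Proof. by rewrite regular_coefE hopf_mul1l r2vK !mxE eqxx. Qed.

Lemma convolution_bilinear : bilinear_for *:%R *:%R convolution.
Proof.
split=> c a f g; apply: dual_ext => i j;
  rewrite add_lfunE scale_lfunE;
  rewrite !(convolution_comatrix _ _ _ _ (coef_comatrix B));
  rewrite scaler_sumr -big_split; apply: eq_bigr => e _;
  rewrite add_lfunE scale_lfunE.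
  by rewrite mulrDl -scalerAl.
by rewrite mulrDr; congr (_ + _); apply: mulrCA.
Qed.

Let cT := coef_comatrix B.

Lemma convolutionA : associative convolution.
Proof.
move=> f g h; apply: dual_ext => i j.
rewrite !(convolution_comatrix _ _ _ _ cT).
under eq_bigr => e _ do rewrite (convolution_comatrix _ _ _ _ cT) mulr_sumr.
under [in RHS]eq_bigr => e _ do
  rewrite (convolution_comatrix _ _ _ _ cT) mulr_suml.
rewrite exchange_big; apply: eq_bigr => e _; apply: eq_bigr => l _.
exact: mulrA.
Qed.

Lemma convolution1l : left_id (ep : dual H) convolution.
Proof.
move=> f; apply: dual_ext => i j; rewrite (convolution_comatrix _ _ _ _ cT).
under eq_bigr do rewrite hopf_counit_coef.
exact: (sum_deltal i (fun e => f (T e j))).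
Qed.

Lemma convolution1r : right_id (ep : dual H) convolution.
Proof.
move=> f; apply: dual_ext => i j; rewrite (convolution_comatrix _ _ _ _ cT).
under eq_bigr do rewrite hopf_counit_coef mulrC.
exact: (sum_deltar j (fun e => f (T i e))).
Qed.

Lemma regular_coef_span f : exists a : 'I_(dim H) -> 'I_(dim H) -> k,
  f = \sum_i \sum_j a i j *: regular_coef i j.
Proof.
(* The coefficients come from writing [f c] as [f (c ** 1h)] and expanding both [1h] and the
   resulting product in the basis. *)
exists (fun i j => f (coord_basis i) * v2r 1h 0 j); apply/lfunP => c.
rewrite sum_lfunE -[in LHS](hopf_mul1r B c) (coord_basisE (c ** 1h)) linear_sum.
apply: eq_bigr => i _; rewrite linearZ sum_lfunE /=.
rewrite [in LHS](coord_basisE 1h) linear_sumr linear_sum summxE scaler_suml.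
apply: eq_bigr => j _.
rewrite scale_lfunE linearZr_LR linearZ mxE regular_coefE.
by rewrite /GRing.scale /= mulrC mulrA.
Qed.

Lemma dual_hopf_comul_coef i j :
  dual_hopf_comul (regular_coef i j)
  = \sum_e regular_coef i e \ox regular_coef e j.
Proof.
apply: dual_tens_ext => a b.
by rewrite dual_hopf_comul_pair dual_pair_sum regular_coefM.
Qed.

Lemma dual_hopf_counit_coef i j :
  dual_hopf_counit (regular_coef i j) = (i == j)%:R.
Proof. by rewrite dual_hopf_counitE regular_coef1. Qed.

(** This is the transpose of multiplicativity of the coproduct of [H]. Evaluated at two coefficients
    [T a1 a2] and [T b1 b2], whose product is a coefficient of a Kronecker product, both sides are
    the same sums of fourfold products of scalars. *)
Lemma dual_hopf_comulM i j l m :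
  dual_hopf_comul (convolution (regular_coef i j) (regular_coef l m))
  = \sum_e \sum_f convolution (regular_coef i e) (regular_coef l f)
                    \ox convolution (regular_coef e j) (regular_coef f m).
Proof.
apply: dual_tens_ext => a b; rewrite dual_hopf_comul_pair.
rewrite pair_bigA dual_pair_sum /=.
move: a; apply: (@coef_ext _ _ B k^o) => [||a1 a2]; [by repeat islin_hopf..|].
move: b; apply: (@coef_ext _ _ B k^o) => [||b1 b2]; [by repeat islin_hopf..|].
have := convolution_comatrix (regular_coef i j) (regular_coef l m)
  (a1, b1) (a2, b2) (comatrix_mul cT cT).
move=> /= ->.
rewrite -(pair_bigA _ (fun e f =>
  convolution (regular_coef i e) (regular_coef l f) (T a1 a2)
  * convolution (regular_coef e j) (regular_coef f m) (T b1 b2))) /=.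
under [RHS]eq_bigr do under eq_bigr do
  rewrite !(convolution_comatrix _ _ _ _ cT) big_distrlr /= pair_bigA /=.
rewrite pair_bigA exchange_big /=; apply: eq_bigr => -[e f] _ /=.
rewrite !regular_coefM big_distrlr /= pair_bigA /=.
apply: eq_bigr => -[u v] _ /=.
by rewrite mulrACA.
Qed.

Lemma dual_hopf_comul1 :
  dual_hopf_comul (ep : dual H) = (ep : dual H) \ox (ep : dual H).
Proof.
apply: dual_tens_ext => a b; rewrite dual_hopf_comul_pair hopf_counitM.
(* The pure tensor is treated as a sum with one term. *)
have := @dual_pair_sum _ _ _ [:: tt] (fun=> ep) (fun=> ep) a b.
by rewrite !big_seq1.
Qed.

Lemma dual_hopf_counitM f g :
  dual_hopf_counit (convolution f g) = dual_hopf_counit f * dual_hopf_counit g.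
Proof.
rewrite !dual_hopf_counitE (convolution_comatrix f g ord0 ord0 (comatrix1 B)).
by rewrite big_ord1.
Qed.

Lemma dual_hopf_counit1 : dual_hopf_counit (ep : dual H) = 1.
Proof. by rewrite dual_hopf_counitE hopf_counit1. Qed.

Lemma dual_hopf_antipodel i j :
  \sum_e convolution (dual_hopf_antipode (regular_coef i e)) (regular_coef e j)
  = (i == j)%:R *: (ep : dual H).
Proof.
apply: dual_ext => a b; rewrite sum_lfunE scale_lfunE hopf_counit_coef.
under eq_bigr do rewrite (convolution_comatrix _ _ _ _ cT).
rewrite exchange_big /=.
under eq_bigr => e _.
  under eq_bigr => f _ do rewrite dual_hopf_antipodeE.
  rewrite -regular_coefM; over.
by rewrite -linear_sum hopf_antipodel linearZ /= regular_coef1; apply: mulrC.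
Qed.

Lemma dual_hopf_antipoder i j :
  \sum_e convolution (regular_coef i e) (dual_hopf_antipode (regular_coef e j))
  = (i == j)%:R *: (ep : dual H).
Proof.
apply: dual_ext => a b; rewrite sum_lfunE scale_lfunE hopf_counit_coef.
under eq_bigr do rewrite (convolution_comatrix _ _ _ _ cT).
rewrite exchange_big /=.
under eq_bigr => e _.
  under eq_bigr => f _ do rewrite dual_hopf_antipodeE.
  rewrite -regular_coefM; over.
by rewrite -linear_sum hopf_antipoder linearZ /= regular_coef1; apply: mulrC.
Qed.

Definition dual_hopf : hopf (dual H) :=
  Hopf convolution_bilinear convolutionA convolution1l convolution1r
    regular_coef_span dual_hopf_comul_coef dual_hopf_counit_coef
    dual_hopf_comulM dual_hopf_comul1 dual_hopf_counitM dual_hopf_counit1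
    dual_hopf_antipodel dual_hopf_antipoder.

End DualHopf.

(** * The antipode on the coalgebra, and its inverse *)

Section AntipodeComatrix.
Variables (k : fieldType) (H : vectType k) (B : hopf H).
Local Notation "x ** y" := (hopf_mul B x y) (at level 40, left associativity).
Local Notation "1h" := (hopf_one B).
Local Notation De := (hopf_comul B).
Local Notation ep := (hopf_counit B).
Local Notation S := (hopf_antipode B).
Local Notation T := (@hopf_coef k H B).

(* Anti-comultiplicativity of S is anti-multiplicativity of the antipode of   *)
(* the dual.                                                                  *)
Lemma antipode_comul c : De (S c) = \sw_(x, y <- De c) S y \ox S x.
Proof.
apply: tens_dual_ext => f g.
rewrite (@sw_lin _ _ _ _ k^o (fun z => \sw_(u, v <- z) (f u * g v : k^o)));
  last by repeat islin_step.
rewrite -convolutionE -dual_hopf_antipodeE.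
rewrite [dual_hopf_antipode B _](antipodeM (dual_hopf B)) convolutionE.
apply: eq_sw => u v; rewrite sw_tensor; try by move=> ?; repeat islin_step.
by rewrite !dual_hopf_antipodeE mulrC.
Qed.

(** The counit applied to the antipode axiom on [T]: since it sends [T e j] to a Kronecker delta,
    only one term survives. *)
Lemma antipode_counit c : ep (S c) = ep c.
Proof.
apply: (@coef_ext _ _ B k^o (fun c => ep (S c))) => [||i j];
  try by repeat islin_hopf.
have /(congr1 ep) := hopf_antipodel i j.
rewrite linear_sum linearZ /= hopf_counit1 => E.
rewrite hopf_counit_coef -[RHS]mulr1 -[RHS]E.
under eq_bigr => e _ do rewrite hopf_counitM hopf_counit_coef mulrC.
by rewrite (sum_deltar j (fun e => ep (S (T i e)))).
Qed.

(** The contragredient comodule; the transposition makes up for [S] reversing the coproduct. *)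
Lemma comatrix_antipode (J : finType) (M : J -> J -> H) :
  comatrix B M -> comatrix B (fun i j => S (M j i)).
Proof.
move=> cM; split=> i j; last by rewrite antipode_counit (proj2 cM) eq_sym.
by rewrite antipode_comul sw_comatrix //; move=> ?; repeat islin_hopf.
Qed.

Definition antipode_inv : 'End(H) := (S^-1)%VF.
Local Notation Si := antipode_inv.

Lemma antipodeK : cancel S Si.
Proof. exact/lker0_lfunK/antipode_lker0. Qed.

Lemma antipode_invK : cancel Si S.
Proof. exact/lker0_lfunVK/antipode_lker0. Qed.

(** Applying [S] gives back the antipode axiom. With [antipode_invr], this makes the inverse of [S]
    the antipode of the opposite algebra. *)
Lemma antipode_invl i j :
  \sum_e Si (T e j) ** T i e = (i == j)%:R *: 1h.
Proof.
apply: (can_inj antipodeK); rewrite linear_sum linearZ /= antipode1.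
rewrite -hopf_antipodel; apply: eq_bigr => e _.
by rewrite antipodeM antipode_invK.
Qed.

Lemma antipode_invr i j :
  \sum_e T e j ** Si (T i e) = (i == j)%:R *: 1h.
Proof.
apply: (can_inj antipodeK); rewrite linear_sum linearZ /= antipode1.
rewrite -hopf_antipoder; apply: eq_bigr => e _.
by rewrite antipodeM antipode_invK.
Qed.

End AntipodeComatrix.

(** * The ordinary double *)

Section Coadjoint.
Variables (k : fieldType) (H : vectType k) (B : hopf H).
Local Notation "x ** y" := (hopf_mul B x y) (at level 40, left associativity).
Local Notation "1h" := (hopf_one B).
Local Notation ep := (hopf_counit B : dual H).
Local Notation S := (hopf_antipode B).
Local Notation T := (@hopf_coef k H B).
Local Notation F := (dual_hopf B).
Local Notation "f <*> g" := (hopf_mul F f g) (at level 40, left associativity).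
Let cT := coef_comatrix B.

(** The product of the double inserts the two outer legs of an iterated coproduct for [x] and [y];
    keeping them independent makes the expression linear in each. *)
Definition coadj (f : dual H) (x y : H) : dual H :=
  linfun (fun a : H => f (S x ** (a ** y)) : k^o).

Lemma coadjE f x y a : coadj f x y a = f (S x ** (a ** y)).
Proof. by apply: linfunE; rewrite -/(islin _); repeat islin_hopf. Qed.

Lemma islin_coadj1 (V : vectType k) (G : V -> dual H) x y :
  islin G -> islin (fun v => coadj (G v) x y).
Proof.
move=> GL a u v; apply/lfunP => b; rewrite add_lfunE scale_lfunE !coadjE GL.
by rewrite add_lfunE scale_lfunE.
Qed.

Lemma islin_coadj2 (V : vectType k) (G : V -> H) f y :
  islin G -> islin (fun v => coadj f (G v) y).
Proof.
move=> GL a u v; apply/lfunP => b; rewrite add_lfunE scale_lfunE !coadjE GL.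
by rewrite linearP linearPl linearP.
Qed.

Lemma islin_coadj3 (V : vectType k) (G : V -> H) f x :
  islin G -> islin (fun v => coadj f x (G v)).
Proof.
move=> GL a u v; apply/lfunP => b; rewrite add_lfunE scale_lfunE !coadjE GL.
by rewrite !linearPr linearP.
Qed.

Lemma coadj_coadj f x y x' y' :
  coadj (coadj f x y) x' y' = coadj f (x' ** x) (y' ** y).
Proof. by apply/lfunP => a; rewrite !coadjE antipodeM !hopf_mulA. Qed.

Lemma coadj1 f : coadj f 1h 1h = f.
Proof. by apply/lfunP => a; rewrite coadjE antipode1 hopf_mul1l hopf_mul1r. Qed.

Lemma coadj_counit x y : coadj ep x y = ep y *: (ep x *: ep).
Proof.
apply/lfunP => a; rewrite coadjE !scale_lfunE !hopf_counitM antipode_counit.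
by rewrite mulrA mulrC.
Qed.

(** The value at [T i j] is [f <*> g] at a coefficient of the product of three comatrices: the
    transposed antipode of [M], then [T], then [N]. The transposition is why [f] receives [M e b]
    and [g] receives [M a e]. *)
Lemma coadj_conv (J L : finType) (M : J -> J -> H) (N : L -> L -> H)
    f g a b c d :
  comatrix B M -> comatrix B N ->
  coadj (f <*> g) (M a b) (N c d)
  = \sum_e \sum_l coadj f (M e b) (N c l) <*> coadj g (M a e) (N l d).
Proof.
move=> cM cN; apply: (@dual_ext _ _ B) => i j; rewrite coadjE.
have cSM := comatrix_antipode cM.
have := convolution_comatrix f g (b, (i, c)) (a, (j, d))
  (comatrix_mul cSM (comatrix_mul cT cN)).
rewrite /= => ->; rewrite sum_lfunE.
rewrite -(pair_bigA _ (fun e q => f (S (M e b) ** (T i q.1 ** N c q.2))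
   * g (S (M a e) ** (T q.1 j ** N q.2 d)))); apply: eq_bigr => e _ /=.
rewrite -(pair_bigA _ (fun m l => f (S (M e b) ** (T i m ** N c l))
   * g (S (M a e) ** (T m j ** N l d)))) exchange_big /= sum_lfunE.
apply: eq_bigr => l _; rewrite (convolution_comatrix _ _ _ _ cT).
by apply: eq_bigr => m _; rewrite !coadjE.
Qed.

End Coadjoint.

Ltac islin_coadj := first [ islin_hopf
  | apply: islin_coadj1 | apply: islin_coadj2 | apply: islin_coadj3 ].

Definition double_mul (k : fieldType) (H : vectType k) (B : hopf H)
    (s t : tens H (dual H)) : tens H (dual H) :=
  \sw_(h, f <- s) \sw_(x, g <- t)
    \sw_(x1, x2 <- hopf_comul B x) \sw_(x21, x22 <- hopf_comul B x2)
      hopf_mul B x21 h \ox hopf_mul (dual_hopf B) (coadj B f x1 x22) g.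

Lemma islin_dmull (k : fieldType) (V H : vectType k) (B : hopf H)
    (G : V -> tens H (dual H)) t :
  islin G -> islin (fun v => double_mul B (G v) t).
Proof. by move=> GL; repeat islin_coadj. Qed.

Lemma islin_dmulr (k : fieldType) (V H : vectType k) (B : hopf H)
    (G : V -> tens H (dual H)) s :
  islin G -> islin (fun v => double_mul B s (G v)).
Proof. by move=> GL; repeat islin_coadj. Qed.

Ltac islin_double :=
  first [ apply: islin_dmull | apply: islin_dmulr | islin_coadj ].

(** * Hopf algebra structure on the double *)

Section Double.
Variables (k : fieldType) (H : vectType k) (B : hopf H).
Local Notation "x ** y" := (hopf_mul B x y) (at level 40, left associativity).
Local Notation "1h" := (hopf_one B).
Local Notation De := (hopf_comul B).
Local Notation ep := (hopf_counit B : dual H).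
Local Notation S := (hopf_antipode B).
Local Notation Si := (antipode_inv B).
Local Notation I := (hopf_index B).
Local Notation T := (@hopf_coef k H B).
Local Notation F := (dual_hopf B).
Local Notation "f <*> g" := (hopf_mul F f g) (at level 40, left associativity).
Local Notation U := (regular_coef B).
Local Notation K := (tens H (dual H)).
Let cT := coef_comatrix B.
Let cU : comatrix F U := coef_comatrix F.

Lemma double_mul_sw h f x g : double_mul B (h \ox f) (x \ox g)
  = \sw_(x1, x2 <- De x) \sw_(x21, x22 <- De x2)
      (x21 ** h) \ox (coadj B f x1 x22 <*> g).
Proof.
rewrite /double_mul sw_tensor; try by move=> ?; repeat islin_double.
by rewrite sw_tensor //; move=> ?; repeat islin_double.
Qed.

(** The comatrix is arbitrary because the formula is applied to [T], to products of coefficients, to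
    the unit and to images under an automorphism. *)
Lemma double_mulE (J : finType) (M : J -> J -> H) h f a b g :
  comatrix B M ->
  double_mul B (h \ox f) (M a b \ox g)
  = \sum_c \sum_d (M c d ** h) \ox (coadj B f (M a c) (M d b) <*> g).
Proof.
move=> cM; rewrite double_mul_sw sw_comatrix //;
  try by move=> ?; repeat islin_double.
by apply: eq_bigr => e _; rewrite sw_comatrix //; move=> ?; repeat islin_double.
Qed.

Lemma double_ext (W : vectType k) (P Q : K -> W) :
  islin P -> islin Q ->
  (forall i j f, P (T i j \ox f) = Q (T i j \ox f)) -> forall t, P t = Q t.
Proof.
move=> PL QL PQ; apply: tens_ext => // u f; move: u.
have comp (R : K -> W) : islin R -> islin (fun u => R (u \ox f)).
  by move=> RL a x y; rewrite linearPl RL.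
by apply: coef_ext => //; apply: comp.
Qed.

(** On coefficients both sides are sums over six indices. On the left [T m n ** T a b] is a
    coefficient of a product comatrix; on the right [coadj_conv] distributes the action over the
    convolution. After reindexing, [coadj_coadj] and associativity in both factors identify the
    summands. *)
Lemma double_mulA : associative (double_mul B).
Proof.
move=> s t u.
move: s; apply: double_ext => [||h0 h1 f]; [by repeat islin_double..|].
move: (T h0 h1) => h {h0 h1}.
move: t; apply: double_ext => [||a b g]; [by repeat islin_double..|].
move: u; apply: double_ext => [||i j p]; [by repeat islin_double..|].
rewrite !(double_mulE _ _ _ _ _ cT).
rewrite (islin_bigsum (F := double_mul B _)); last by repeat islin_double.
under eq_bigr => m _.
  rewrite (islin_bigsum (F := double_mul B _)); last by repeat islin_double.
  under eq_bigr => n _ do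
    rewrite (double_mulE _ _ (m, a) (n, b) _ (comatrix_mul cT cT)) /=.
  over.
rewrite (islin_bigsum (F := (double_mul B)^~ _)); last by repeat islin_double.
under [RHS]eq_bigr => c _.
  rewrite (islin_bigsum (F := (double_mul B)^~ _)); last by repeat islin_double.
  under eq_bigr => d _.
    rewrite (double_mulE _ _ _ _ _ cT).
    under eq_bigr => q _. under eq_bigr => l _.
      rewrite (coadj_conv _ _ _ _ _ _ cT cT) linear_sumlz linear_sumr.
      under eq_bigr => m _ do rewrite linear_sumlz linear_sumr.
      over.
    over.
  over.
over.
rewrite !pair_bigA /=.
rewrite (reindex (fun p : I * I * I * I * I * I =>
  let: (c, d, q, l, m, n) := p in ((m, n), (q, c), (l, d)))) /=; last first.
  exists (fun p : I * I * (I * I) * (I * I) =>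
    let: ((m, n), (q, c), (l, d)) := p in (c, d, q, l, m, n));
    by move=> [[[[[? ?] ?] ?] ?] ?] _ || move=> [[[? ?] [? ?]] [? ?]] _.
apply: eq_bigr => -[[[[[c d] q] l] m] n] _ /=.
by rewrite coadj_coadj !hopf_mulA convolutionA.
Qed.

Definition double_one : K := 1h \ox ep.

(** Here and in [double_mul_op] the action is trivial. These two cases exhibit both factors as
    subalgebras and suffice for the unit and antipode axioms. *)
Lemma double_mul_dual h f g :
  double_mul B (h \ox f) (1h \ox g) = h \ox (f <*> g).
Proof.
rewrite (double_mulE _ _ ord0 ord0 _ (comatrix1 B)) !big_ord1.
by rewrite hopf_mul1l coadj1.
Qed.

Lemma double_mul_op h x g :
  double_mul B (h \ox ep) (x \ox g) = (x ** h) \ox g.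
Proof.
move: x; apply: (@coef_ext _ _ B) => [||i j]; try by repeat islin_double.
rewrite (double_mulE _ _ _ _ _ cT).
under eq_bigr => e _.
  under eq_bigr => l _ do
    rewrite coadj_counit !hopf_counit_coef !linearZl_LR !linearZr_LR /=
      convolution1l.
  rewrite (sum_deltar j (fun l => (i == e)%:R *: ((T e l ** h) \ox g))); over.
exact: (sum_deltal i (fun e => (T e j ** h) \ox g)).
Qed.

Lemma double_mul1l : left_id double_one (double_mul B).
Proof.
apply: tens_ext => [||x g]; try by repeat islin_double.
by rewrite double_mul_op hopf_mul1r.
Qed.

Lemma double_mul1r : right_id double_one (double_mul B).
Proof.
apply: tens_ext => [||x g]; try by repeat islin_double.
by rewrite double_mul_dual (convolution1r B g : g <*> ep = g).
Qed.

Definition double_comul_fun (t : K) : tens K K :=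
  \sw_(h, f <- t) \sw_(h1, h2 <- De h) \sw_(f1, f2 <- hopf_comul F f)
    (h1 \ox f1) \ox (h2 \ox f2).

Definition double_comul : 'Hom(K, tens K K) := linfun double_comul_fun.

Lemma double_comulE h f : double_comul (h \ox f)
  = \sw_(h1, h2 <- De h) \sw_(f1, f2 <- hopf_comul F f)
      (h1 \ox f1) \ox (h2 \ox f2).
Proof.
rewrite [LHS](@linfunE _ _ _ double_comul_fun).
  by rewrite /double_comul_fun sw_tensor //; move=> ?; repeat islin_double.
by rewrite -/(islin _); repeat islin_double.
Qed.

Lemma double_comul_comatrix (J : finType) (M : J -> J -> H) i j f :
  comatrix B M ->
  double_comul (M i j \ox f)
  = \sum_e \sw_(f1, f2 <- hopf_comul F f) (M i e \ox f1) \ox (M e j \ox f2).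
Proof.
move=> cM.
by rewrite double_comulE sw_comatrix //; move=> ?; repeat islin_double.
Qed.

Definition double_counit_fun (t : K) : k^o := 
  tens_lift (fun (h : H) (f : dual H) => ep h * f 1h : k^o) t.

Definition double_counit : 'Hom(K, k^o) := linfun double_counit_fun.

Lemma double_counitE h f : double_counit (h \ox f) = ep h * f 1h.
Proof.
rewrite [LHS](@linfunE _ _ _ double_counit_fun).
  by rewrite /double_counit_fun sw_tensor //; move=> ?; repeat islin_double.
by rewrite -/(islin _); repeat islin_double.
Qed.

(** As [h \ox f] is the product of [h \ox ep] and [1h \ox f], an antipode has to reverse these
    factors and apply the antipode of each, which on the opposite algebra is [Si]. *)
Definition double_antipode_fun (t : K) : K :=
  \sw_(h, f <- t) double_mul B (1h \ox hopf_antipode F f) (Si h \ox ep).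

Definition double_antipode : 'End(K) := linfun double_antipode_fun.

Lemma double_antipodeE h f : double_antipode (h \ox f)
  = double_mul B (1h \ox hopf_antipode F f) (Si h \ox ep).
Proof.
rewrite [LHS](@linfunE _ _ _ double_antipode_fun).
  by rewrite /double_antipode_fun sw_tensor //; move=> ?; repeat islin_double.
by rewrite -/(islin _); repeat islin_double.
Qed.

Lemma double_mul_bilinear : bilinear_for *:%R *:%R (double_mul B).
Proof. by split=> c; rewrite -/(islin _); repeat islin_double. Qed.

Definition double_coef (p q : I * 'I_(dim H)) : K := T p.1 q.1 \ox U p.2 q.2.

Lemma double_coef_span c : exists a : I * 'I_(dim H) -> I * 'I_(dim H) -> k,
  c = \sum_p \sum_q a p q *: double_coef p q.
Proof.
(* The property is closed under sums and scalar multiples, which leaves only the tensors of spanning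
   elements. *)
pose P (c : K) := exists a : I * 'I_(dim H) -> I * 'I_(dim H) -> k,
  c = \sum_p \sum_q a p q *: double_coef p q.
have P0 : P 0.
  exists (fun _ _ => 0); rewrite big1 // => p _.
  by rewrite big1 // => q _; rewrite scale0r.
have PD x y : P x -> P y -> P (x + y).
  case=> a -> [b ->]; exists (fun p q => a p q + b p q); rewrite -big_split.
  apply: eq_bigr => p _; rewrite -big_split; apply: eq_bigr => q _.
  exact/esym/scalerDl.
have PZ b x : P x -> P (b *: x).
  case=> a ->; exists (fun p q => b * a p q); rewrite scaler_sumr.
  apply: eq_bigr => p _; rewrite scaler_sumr; apply: eq_bigr => q _.
  exact: scalerA.
have PS (J : finType) (G : J -> K) : (forall i, P (G i)) -> P (\sum_i G i).
  by move=> PG; elim/big_ind: _ => // *; apply: PD.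
have PT i j l m : P (T i j \ox U l m).
  exists (fun p q => (p == (i, l))%:R * (q == (j, m))%:R).
  rewrite (bigD1 (i, l)) //= (bigD1 (j, m)) //= !eqxx mul1r scale1r.
  rewrite big1 ?addr0 => [|q /negPf ->]; last by rewrite mulr0 scale0r.
  rewrite big1 ?addr0 // => p /negPf ->.
  by rewrite big1 // => q _; rewrite mul0r scale0r.
rewrite -/(P c) (tensE c); apply: (PS) => i; apply: (PS) => j; apply: (PZ).
have [a ->] := hopf_coef_span B (coord_basis i).
have [b ->] := regular_coef_span B (coord_basis j).
rewrite linear_sumlz; apply: (PS) => i1.
rewrite linear_sumlz; apply: (PS) => i2.
rewrite linearZl_LR; apply: (PZ).
rewrite linear_sumr; apply: (PS) => j1.
rewrite linear_sumr; apply: (PS) => j2.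
by rewrite linearZr_LR; apply: (PZ); apply: PT.
Qed.

Lemma double_comul_coef p q :
  double_comul (double_coef p q)
  = \sum_e double_coef p e \ox double_coef e q.
Proof.
rewrite (double_comul_comatrix _ _ _ cT) -(pair_bigA _ (fun e f =>
  (T p.1 e \ox U p.2 f) \ox (T e q.1 \ox U f q.2))); apply: eq_bigr => e _ /=.
by rewrite (sw_comatrix _ _ cU) //; move=> ?; repeat islin_double.
Qed.

Lemma double_counit_coef p q : double_counit (double_coef p q) = (p == q)%:R.
Proof.
by rewrite double_counitE hopf_counit_coef regular_coef1 -natrM mulnb.
Qed.

Lemma double_comul1 :
  double_comul double_one = double_one \ox double_one.
Proof.
rewrite double_comulE hopf_comul1 sw_tensor;
  try by move=> ?; repeat islin_double.
rewrite (hopf_comul1 F : hopf_comul F ep = ep \ox ep) sw_tensor //;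
  by move=> ?; repeat islin_double.
Qed.

Lemma double_counit1 : double_counit double_one = 1.
Proof. by rewrite double_counitE !hopf_counit1 mulr1. Qed.

(** The counit turns the middle leg [T c d] into a Kronecker delta, so the outer legs become
    adjacent and cancel by the antipode axiom. *)
Lemma double_counitM s t :
  double_counit (double_mul B s t) = double_counit s * double_counit t.
Proof.
move: s; apply: (@tens_ext _ _ _ k^o) => [||h f]; try by repeat islin_double.
move: t; apply: (@double_ext k^o) => [||i j g];
  try by repeat islin_double.
rewrite (double_mulE _ _ _ _ _ cT) linear_sum /=.
have E c d : double_counit ((T c d ** h) \ox (coadj B f (T i c) (T d j) <*> g))
    = (c == d)%:R *: (ep h * (f (S (T i c) ** T d j) * g 1h) : k^o).
  rewrite double_counitE hopf_counitM hopf_counit_coef.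
  rewrite (convolution_comatrix _ _ ord0 ord0 (comatrix1 B)) big_ord1 coadjE.
  by rewrite hopf_mul1l; apply/esym/mulrA.
under eq_bigr => c _.
  rewrite linear_sum /=; under eq_bigr => d _ do rewrite E.
  rewrite (sum_deltal c (fun d =>
    ep h * (f (S (T i c) ** T d j) * g 1h) : k^o)).
  over.
rewrite -mulr_sumr -mulr_suml -linear_sum hopf_antipodel linearZ /=.
rewrite !double_counitE hopf_counit_coef.
rewrite -[RHS]mulrA; congr (_ * _).
rewrite [RHS]mulrA; congr (_ * _).
exact: mulrC.
Qed.

(* The coproducts of the two outer arguments of coadj cancel in the middle.  *)
Lemma coadj_comul c d i m r s t j :
  \sum_e \sum_f coadj B (U c e) (T i m) (T r f)
                  \ox coadj B (U e d) (T f s) (T t j)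
  = (r == s)%:R *: hopf_comul F (coadj B (U c d) (T i m) (T t j)).
Proof.
apply: dual_tens_ext => x y.
rewrite pair_bigA dual_pair_sum /dual_pair.
rewrite (islinZ (@tens_lift_linear k _ _ _ _)).
rewrite -/(dual_pair _ x y) [dual_pair _ x y]dual_hopf_comul_pair.
rewrite -(pair_bigA _ (fun e f => coadj B (U c e) (T i m) (T r f) x
   * coadj B (U e d) (T f s) (T t j) y)) exchange_big /=.
under eq_bigr => f _.
  under eq_bigr => e _ do rewrite !coadjE.
  rewrite -regular_coefM; over.
have E f : S (T i m) ** (x ** T r f) ** (S (T f s) ** (y ** T t j))
  = S (T i m) ** (x ** ((T r f ** S (T f s)) ** (y ** T t j))).
  by rewrite !hopf_mulA.
under eq_bigr do rewrite E.
rewrite -linear_sum -!linear_sumr -linear_sumlz hopf_antipoder.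
by rewrite linearZl_LR !linearZr_LR linearZ /= hopf_mul1l coadjE !hopf_mulA.
Qed.

(** Comultiplying the product yields the coproduct of one functional [coadj], with a single index
    [r] joining the middle legs. Multiplying the coproducts yields two functionals [coadj] with
    independent [r] and [s]. The identity [coadj_comul] relates the two. *)
Lemma double_comulM p q u v :
  double_comul (double_mul B (double_coef p q) (double_coef u v))
  = \sum_e \sum_f double_mul B (double_coef p e) (double_coef u f)
                  \ox double_mul B (double_coef e q) (double_coef f v).
Proof.
case: p q u v => [a c] [b d] [i p] [j q].
pose Phi e1 f2 m r s t (x y : dual H) : tens K K :=
  ((T m r ** T a e1) \ox (x <*> U p f2))
    \ox ((T s t ** T e1 b) \ox (y <*> U f2 q)).
have PhiL e1 f2 m r s t x : islin (Phi e1 f2 m r s t x) by repeat islin_double.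
have PhiR e1 f2 m r s t y : islin ((Phi e1 f2 m r s t)^~ y).
  by repeat islin_double.
transitivity (\sum_m \sum_t \sum_r \sum_e1 \sum_f2
  \sw_(x, y <- hopf_comul F (coadj B (U c d) (T i m) (T t j)))
     Phi e1 f2 m r r t x y).
  rewrite (double_mulE _ _ _ _ _ cT) linear_sum; apply: eq_bigr => m _.
  rewrite linear_sum; apply: eq_bigr => t _ /=.
  have := double_comul_comatrix (m, a) (t, b)
    (coadj B (U c d) (T i m) (T t j) <*> U p q)
    (comatrix_mul cT cT).
  set D := hopf_comul F (_ <*> _) => /= ->.
  rewrite -(pair_bigA _ (fun r e1 => \sw_(f1, f2 <- D)
    ((T m r ** T a e1) \ox f1) \ox ((T r t ** T e1 b) \ox f2))) /=.
  apply: eq_bigr => r _; apply: eq_bigr => e1 _.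
  rewrite -sw_bigsum /D comul_mul.
  rewrite (@sw_lin _ _ _ _ _ (fun z => \sw_(x, y <- z)
      ((T m r ** T a e1) \ox x) \ox ((T r t ** T e1 b) \ox y)));
    last by repeat islin_double.
  apply: eq_sw => x y.
  rewrite (sw_comatrix _ _ cU); try by move=> ?; repeat islin_double.
  by rewrite sw_sum //; move=> ?; repeat islin_double.
transitivity (\sum_m \sum_t \sum_r \sum_e1 \sum_f2 \sum_s \sum_g
  Phi e1 f2 m r s t (coadj B (U c g.1) (T i m) (T r g.2))
    (coadj B (U g.1 d) (T g.2 s) (T t j))).
  apply: eq_bigr => m _; apply: eq_bigr => t _; apply: eq_bigr => r _.
  apply: eq_bigr => e1 _; apply: eq_bigr => f2 _.
  (* The second index [s] is introduced by a Kronecker delta, so that [coadj_comul] can be used from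
     right to left. *)
  rewrite -[LHS](sum_deltal r (fun s => \sw_(x, y <- hopf_comul F
    (coadj B (U c d) (T i m) (T t j))) Phi e1 f2 m r s t x y)).
  apply: eq_bigr => s _.
  rewrite -(islinZ (@tens_lift_linear k _ _ _ _)) -coadj_comul pair_bigA /=.
  exact: sw_sum.
symmetry; rewrite /double_coef /=.
under eq_bigr => e _.
  under eq_bigr => f _.
    rewrite !(double_mulE _ _ _ _ _ cT) linear_sumlz.
    under eq_bigr => m _.
      rewrite linear_sumlz; under eq_bigr => r _.
        rewrite linear_sumr; under eq_bigr => s _.
          rewrite linear_sumr; over.
        over.
      over.
    over.
  over.
rewrite !pair_bigA /=.
(* The two sums differ only in the order of their eight indices. *)
rewrite (reindex (fun z : I * I * I * I * 'I_(dim H) * I * ('I_(dim H) * I) =>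
  let: (m, t, r, e1, f2, s, (e2, f1)) := z in
  ((e1, e2), (f1, f2), m, r, s, t))) /=; last first.
  exists (fun z : (I * 'I_(dim H)) * (I * 'I_(dim H)) * I * I * I * I =>
    let: ((e1, e2), (f1, f2), m, r, s, t) := z in
    (m, t, r, e1, f2, s, (e2, f1))).
    by move=> [[[[[[? ?] ?] ?] ?] ?] [? ?]] _.
  by move=> [[[[[[? ?] [? ?]] ?] ?] ?] ?] _.
by apply: eq_bigr => -[[[[[[? ?] ?] ?] ?] ?] [? ?]] _.
Qed.

(** Associativity brings the two elements of [H] together, where they cancel by [antipode_invr]; the
    two functionals then cancel by the antipode axiom of the dual. In [double_antipoder] the
    functionals meet first. *)
Lemma double_antipodel p q :
  \sum_e double_mul B (double_antipode (double_coef p e)) (double_coef e q)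
  = (p == q)%:R *: double_one.
Proof.
case: p q => [a c] [b d]; rewrite -(pair_bigA _ (fun e f =>
  double_mul B (double_antipode (T a e \ox U c f)) (T e b \ox U f d))).
rewrite exchange_big /=.
have E f x y g : double_mul B (double_mul B (1h \ox f) (x \ox ep)) (y \ox g)
   = double_mul B (1h \ox f) ((y ** x) \ox g).
  by rewrite -double_mulA double_mul_op.
under eq_bigr => f _.
  under eq_bigr => e _ do rewrite double_antipodeE E.
  rewrite -(islin_bigsum (F := double_mul B _)); last by repeat islin_double.
  rewrite -linear_sumlz antipode_invr linearZl_LR.
  rewrite (islinZ (F := double_mul B _)); last by repeat islin_double.
  rewrite double_mul_dual; over.
rewrite -scaler_sumr -linear_sumr (hopf_antipodel (h := F)) linearZr_LR /=.
by rewrite scalerA -natrM mulnb.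
Qed.

Lemma double_antipoder p q :
  \sum_e double_mul B (double_coef p e) (double_antipode (double_coef e q))
  = (p == q)%:R *: double_one.
Proof.
case: p q => [a c] [b d]; rewrite -(pair_bigA _ (fun e f =>
  double_mul B (T a e \ox U c f) (double_antipode (T e b \ox U f d)))) /=.
have E y g f x : double_mul B (y \ox g) (double_mul B (1h \ox f) (x \ox ep))
   = double_mul B (y \ox (g <*> f)) (x \ox ep).
  by rewrite double_mulA double_mul_dual.
under eq_bigr => e _.
  under eq_bigr => f _ do rewrite double_antipodeE E.
  rewrite -(islin_bigsum (F := (double_mul B)^~ _));
    last by repeat islin_double.
  rewrite -linear_sumr (hopf_antipoder (h := F)) linearZr_LR.
  rewrite (islinZ (F := (double_mul B)^~ _)); last by repeat islin_double.
  rewrite double_mul_op; over.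
rewrite -scaler_sumr -linear_sumlz antipode_invl linearZl_LR /=.
by rewrite scalerA -natrM mulnb andbC.
Qed.

Definition double : hopf K :=
  Hopf double_mul_bilinear double_mulA double_mul1l double_mul1r
    double_coef_span double_comul_coef
    double_counit_coef double_comulM double_comul1 double_counitM
    double_counit1 double_antipodel double_antipoder.

End Double.

(** * Twisting by an automorphism *)

Lemma bij_lfunK (k : fieldType) (V : vectType k) (f : 'End(V)) :
  bijective f -> cancel f f^-1%VF /\ cancel f^-1%VF f.
Proof.
move=> fb; have f0 : lker f == 0%VS by apply/lker0P/bij_inj.
by split; [apply: lker0_lfunK | apply: lker0_lfunVK].
Qed.

Record hopf_auto (k : fieldType) (H : vectType k) (B : hopf H)
    (phi : 'End(H)) : Prop := HopfAuto {
  hopf_auto_bij : bijective phi;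
  hopf_autoM : forall x y, phi (hopf_mul B x y) = hopf_mul B (phi x) (phi y);
  hopf_auto1 : phi (hopf_one B) = hopf_one B;
  hopf_auto_comul : forall c, hopf_comul B (phi c)
    = \sw_(x, y <- hopf_comul B c) phi x \ox phi y;
  hopf_auto_counit : forall c, hopf_counit B (phi c) = hopf_counit B c;
  hopf_auto_antipode : forall c,
    hopf_antipode B (phi c) = phi (hopf_antipode B c)
}.

Section Automorphism.
Variables (k : fieldType) (H : vectType k) (B : hopf H) (phi : 'End(H)).
Hypothesis phiA : hopf_auto B phi.

Lemma comatrix_auto (J : finType) (M : J -> J -> H) :
  comatrix B M -> comatrix B (fun i j => phi (M i j)).
Proof.
move=> cM; split=> i j; last by rewrite (hopf_auto_counit phiA) (proj2 cM).
rewrite (hopf_auto_comul phiA) sw_comatrix //; by move=> ?; repeat islin_step.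
Qed.

Lemma hopf_auto_inv : hopf_auto B phi^-1%VF.
Proof.
have [phiK phiVK] := bij_lfunK (hopf_auto_bij phiA).
have phiI := can_inj phiK.
split.
- by exists phi.
- by move=> x y; apply: phiI; rewrite (hopf_autoM phiA) !phiVK.
- by apply: phiI; rewrite phiVK (hopf_auto1 phiA).
- move=> c; rewrite -{2}[c]phiVK (hopf_auto_comul phiA).
  rewrite (@sw_lin _ _ _ _ _ (fun z =>
      \sw_(x, y <- z) phi^-1%VF x \ox phi^-1%VF y)); last by repeat islin_step.
  rewrite [LHS]tensE; apply: eq_sw => u v.
  by rewrite sw_tensor ?phiK //; move=> ?; repeat islin_step.
- by move=> c; rewrite -{2}[c]phiVK (hopf_auto_counit phiA).
by move=> c; apply: phiI; rewrite -(hopf_auto_antipode phiA) !phiVK.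
Qed.

End Automorphism.

Section Twist.
Variables (k : fieldType) (H : vectType k) (B : hopf H) (phi : 'End(H)).
Hypothesis phiA : hopf_auto B phi.
Local Notation "x ** y" := (hopf_mul B x y) (at level 40, left associativity).
Local Notation De := (hopf_comul B).
Local Notation psi := (phi^-1)%VF.
Let phiK : cancel phi psi := (bij_lfunK (hopf_auto_bij phiA)).1.
Let psiK : cancel psi phi := (bij_lfunK (hopf_auto_bij phiA)).2.
Let cT := coef_comatrix B.
Let psiA := hopf_auto_inv phiA.

Definition twist_mul : 'Hom(tens H H, H) :=
  linfun (fun t : tens H H => phi (\sw_(x, y <- t) x ** y)).

Lemma twist_mulE x y : twist_mul (x \ox y) = phi (x ** y).
Proof.
rewrite linfunE; last by rewrite -/(islin _); repeat islin_hopf.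
by rewrite sw_tensor //; move=> ?; repeat islin_hopf.
Qed.

(** Since [psi] respects the coproduct, this is also the coproduct followed by [psi] in both
    legs. *)
Definition twist_comul : 'Hom(H, tens H H) := (De \o psi)%VF.

Lemma twist_comulE c : twist_comul c = De (psi c).
Proof. exact: comp_lfunE. Qed.

Lemma twist_is_algebra : is_hom_algebra phi twist_mul (hopf_one B).
Proof.
split.
- exact: hopf_auto_bij phiA.
- by move=> a b c; rewrite !twist_mulE -!(hopf_autoM phiA) hopf_mulA.
- by move=> a; rewrite twist_mulE hopf_mul1r.
- by move=> a; rewrite twist_mulE hopf_mul1l.
- by move=> a b; rewrite !twist_mulE (hopf_autoM phiA).
exact: hopf_auto1 phiA.
Qed.

Lemma twist_is_coalgebra :
  is_hom_coalgebra phi twist_comul (hopf_counit B).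
Proof.
(* Each use of the twisted coproduct adds one [psi] to the coefficients. In Hom-coassociativity all
   three legs thus carry [psi] twice, and only the order of summation differs. *)
have c1 := comatrix_auto psiA cT; have c2 := comatrix_auto psiA c1.
split.
- exact: hopf_auto_bij phiA.
- apply: (@coef_ext _ _ B) => [||i j]; try by repeat islin_hopf.
  rewrite !twist_comulE (sw_comatrix _ _ c1);
    try by move=> ?; repeat islin_hopf.
  rewrite (sw_comatrix _ _ c1); try by move=> ?; repeat islin_hopf.
  under eq_bigr => e _.
    rewrite twist_comulE (sw_comatrix _ _ c2);
      try by move=> ?; repeat islin_hopf.
    over.
  under [RHS]eq_bigr => e _.
    rewrite twist_comulE (sw_comatrix _ _ c2);
      try by move=> ?; repeat islin_hopf.
    over.
  exact: exchange_big.
- apply: (@coef_ext _ _ B) => [||i j]; try by repeat islin_hopf.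
  rewrite twist_comulE (sw_comatrix _ _ c1); try by move=> ?; repeat islin_hopf.
  under eq_bigr => e _ do rewrite (proj2 c1).
  exact: (sum_deltar j (fun e => psi (hopf_coef i e))).
- apply: (@coef_ext _ _ B) => [||i j]; try by repeat islin_hopf.
  rewrite twist_comulE (sw_comatrix _ _ c1); try by move=> ?; repeat islin_hopf.
  under eq_bigr => e _ do rewrite (proj2 c1).
  exact: (sum_deltal i (fun e => psi (hopf_coef e j))).
- by move=> c; rewrite !twist_comulE -(hopf_auto_comul phiA) phiK psiK.
exact: hopf_auto_counit phiA.
Qed.

Lemma twist_is_bialgebra :
  is_hom_bialgebra phi twist_mul (hopf_one B) twist_comul (hopf_counit B).
Proof.
split.
- exact: twist_is_algebra.
- exact: twist_is_coalgebra.
- move=> a b; rewrite twist_mulE !twist_comulE phiK.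
  rewrite -[a in LHS]psiK -[b in LHS]psiK -(hopf_autoM phiA).
  rewrite (hopf_auto_comul phiA).
  rewrite comul_mul.
  rewrite (@sw_lin _ _ _ _ _ (fun z => \sw_(x, y <- z) phi x \ox phi y));
    last by repeat islin_step.
  apply: eq_sw => u v.
  rewrite (@sw_lin _ _ _ _ _ (fun z => \sw_(x, y <- z) phi x \ox phi y));
    last by repeat islin_step.
  apply: eq_sw => u' v'.
  by rewrite sw_tensor ?twist_mulE //; move=> ?; repeat islin_step.
- by rewrite twist_comulE (hopf_auto1 psiA) hopf_comul1.
- by move=> a b; rewrite twist_mulE (hopf_auto_counit phiA) hopf_counitM.
exact: hopf_counit1.
Qed.

Lemma twist_is_antipode :
  is_hom_antipode phi twist_mul (hopf_one B) twist_comul (hopf_counit B)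
    (hopf_antipode B).
Proof.
split.
- exact: hopf_auto_antipode phiA.
- move=> h; rewrite twist_comulE -(hopf_auto_counit psiA).
  rewrite -(hopf_auto1 phiA) -linearZ /= -sw_antipodel.
  rewrite (@sw_lin _ _ _ _ _ phi); last by repeat islin_step.
  by apply: eq_sw => u v; rewrite twist_mulE.
- move=> h; rewrite twist_comulE -(hopf_auto_counit psiA).
  rewrite -(hopf_auto1 phiA) -linearZ /= -sw_antipoder.
  rewrite (@sw_lin _ _ _ _ _ phi); last by repeat islin_step.
  by apply: eq_sw => u v; rewrite twist_mulE.
Qed.

Definition twist : homHopfAlgebra H :=
  HomHopfAlgebra twist_is_bialgebra twist_is_antipode.

End Twist.

(** * The ordinary Hopf algebra underlying a monoidal Hom-Hopf algebra *)

Section Untwist.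
Variables (k : fieldType) (H : vectType k) (A : homHopfAlgebra H).
Local Notation alpha := (htwist A).
Local Notation alphaV := ((htwist A)^-1)%VF.
Local Notation "x ** y" := (x *[A] y) (at level 40, left associativity).
Let bA := homHopf_bialgebra A.
Let aA := hom_bialgebra_algebra bA.
Let cA := hom_bialgebra_coalgebra bA.
Let sA := homHopf_antipode A.
Let alphaK : cancel alpha alphaV := (bij_lfunK (hom_twist_bij aA)).1.
Let alphaVK : cancel alphaV alpha := (bij_lfunK (hom_twist_bij aA)).2.
Let alphaI := can_inj alphaK.

Lemma htwist_invM x y : alphaV (x ** y) = alphaV x ** alphaV y.
Proof. by apply: alphaI; rewrite (hom_twistM aA) !alphaVK. Qed.

Definition untwist_mul (x y : H) : H := alphaV (x ** y).

Definition untwist_comul : 'Hom(H, tens H H) := (hcomul A \o alpha)%VF.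

Lemma untwist_comulE c : untwist_comul c = hcomul A (alpha c).
Proof. exact: comp_lfunE. Qed.

Lemma untwist_comul_twist c :
  untwist_comul (alpha c) = \sw_(x, y <- untwist_comul c) alpha x \ox alpha y.
Proof. by rewrite !untwist_comulE (hom_cotwist_comul cA). Qed.

Lemma untwist_mul_bilinear : bilinear_for *:%R *:%R untwist_mul.
Proof.
by split=> c; rewrite -/(islin _) /untwist_mul; repeat islin_step.
Qed.

Lemma untwist_mulA : associative untwist_mul.
Proof.
move=> x y z; rewrite /untwist_mul; congr (alphaV _).
(* Writing [x] as [alpha (alphaV x)] brings the product into the form of Hom-associativity. *)
by rewrite !htwist_invM -{1}[x]alphaVK (hom_mulA aA) alphaVK.
Qed.

Lemma untwist_mul1l : left_id (hone A) untwist_mul.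
Proof. by move=> x; rewrite /untwist_mul (hom_mul1r aA) alphaK. Qed.

Lemma untwist_mul1r : right_id (hone A) untwist_mul.
Proof. by move=> x; rewrite /untwist_mul (hom_mulr1 aA) alphaK. Qed.

(** Hom-coassociativity at [alpha c], with [alpha] applied to all three legs by [a3]: this cancels
    the inverse twist on the outer leg and turns the inner coproduct into the untwisted one. *)
Lemma untwist_comulA c :
  \sw_(x, y <- untwist_comul c) \sw_(y1, y2 <- untwist_comul y)
    x \ox (y1 \ox y2)
  = \sw_(x, y <- untwist_comul c) \sw_(x1, x2 <- untwist_comul x)
    x1 \ox (x2 \ox y).
Proof.
pose a2 (t : tens H H) : tens H H := \sw_(x, y <- t) alpha x \ox alpha y.
pose a3 (t : tens H (tens H H)) := \sw_(x, t' <- t) alpha x \ox a2 t'.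
have a2L : islin a2 by repeat islin_step.
have a3L : islin a3.
  by apply: islin_sw; apply: islin_id.
have a3E x y z : a3 (x \ox (y \ox z)) = alpha x \ox (alpha y \ox alpha z).
  rewrite /a3 sw_tensor => [|v|u]; last 2 first.
  - by repeat islin_step.
  - by move=> b v w; rewrite a2L linearPr.
  by rewrite /a2 sw_tensor //; move=> ?; repeat islin_step.
have := congr1 a3 (hom_comulA cA (alpha c)).
rewrite !(sw_lin _ _ a3L) -untwist_comulE => E.
transitivity (\sw_(u, v <- untwist_comul c)
    a3 (\sw_(c21, c22 <- hcomul A v) alphaV u \ox (c21 \ox c22))).
  apply: eq_sw => x y; rewrite untwist_comulE (hom_cotwist_comul cA).
  rewrite (@sw_lin _ _ _ _ _ (fun z => \sw_(y1, y2 <- z) x \ox (y1 \ox y2)));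
    last by repeat islin_step.
  rewrite (sw_lin _ _ a3L); apply: eq_sw => u v.
  by rewrite sw_tensor ?a3E ?alphaVK //; move=> ?; repeat islin_step.
rewrite E; apply: eq_sw => x y; rewrite untwist_comulE (hom_cotwist_comul cA).
rewrite (@sw_lin _ _ _ _ _ (fun z => \sw_(x1, x2 <- z) x1 \ox (x2 \ox y)));
  last by repeat islin_step.
rewrite (sw_lin _ _ a3L); apply: eq_sw => u v.
by rewrite sw_tensor ?a3E ?alphaVK //; move=> ?; repeat islin_step.
Qed.

(* Matrix coefficients of the regular comodule. *)
Definition corep_coef (i j : 'I_(dim H)) : H :=
  \sw_(x, y <- untwist_comul (coord_basis j)) (coord_form i x *: y).

Lemma coord_form_basis (i j : 'I_(dim H)) :
  coord_form i (coord_basis j) = (i == j)%:R :> k^o.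
Proof. by rewrite coord_formE r2vK mxE eqxx /= eq_sym. Qed.

Lemma untwist_comul_basis j :
  untwist_comul (coord_basis j) = \sum_i coord_basis i \ox corep_coef i j.
Proof.
rewrite [LHS]tensE.
transitivity (tens_lift (fun x y : H =>
    \sum_i coord_basis i \ox (coord_form i x *: y))
  (untwist_comul (coord_basis j))).
  apply: eq_sw => x y; rewrite {1}(coord_basisE x) linear_sumlz.
  by apply: eq_bigr => i _; rewrite linearZl_LR linearZr_LR coord_formE.
rewrite sw_bigsum; apply: eq_bigr => i _; rewrite /corep_coef.
by rewrite (@sw_lin _ _ _ _ _ (fun y => coord_basis i \ox y)) //;
  repeat islin_step.
Qed.

(** Coassociativity at [coord_basis j], after [G] has contracted the first leg with
    [coord_form i]. *)
Lemma untwist_comul_coef i j :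
  untwist_comul (corep_coef i j)
  = \sum_e corep_coef i e \ox corep_coef e j.
Proof.
pose G (t : tens H (tens H H)) := \sw_(x, t' <- t) (coord_form i x *: t').
have GL : islin G by repeat islin_step.
have GE x t : G (x \ox t) = coord_form i x *: t.
  by rewrite /G sw_tensor //; move=> ?; repeat islin_step.
transitivity (G (\sw_(x, y <- untwist_comul (coord_basis j))
   \sw_(y1, y2 <- untwist_comul y) x \ox (y1 \ox y2))).
  rewrite /corep_coef (@sw_lin _ _ _ _ _ untwist_comul);
    last by repeat islin_step.
  rewrite (sw_lin _ _ GL); apply: eq_sw => x y; rewrite (sw_lin _ _ GL).
  rewrite linearZ /= [X in _ *: X]tensE.
  rewrite (@sw_lin _ _ _ _ _ (fun z => coord_form i x *: z));
    last by repeat islin_step.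
  by apply: eq_sw => u v; rewrite GE.
rewrite untwist_comulA untwist_comul_basis sw_sum;
  try by move=> ?; repeat islin_step.
rewrite (islin_bigsum GL); apply: eq_bigr => e _.
rewrite (sw_lin _ _ GL) [in RHS]/corep_coef.
rewrite (@sw_lin _ _ _ _ _ (fun z => z \ox corep_coef e j));
  last by repeat islin_step.
by apply: eq_sw => u v; rewrite GE linearZl_LR.
Qed.

Lemma untwist_counit_coef i j : hcounit A (corep_coef i j) = (i == j)%:R.
Proof.
rewrite /corep_coef (@sw_lin _ _ _ _ k^o (hcounit A));
  last by repeat islin_step.
rewrite -coord_form_basis -[coord_basis j in RHS]alphaK -(hom_counitr cA).
rewrite (@sw_lin _ _ _ _ k^o (coord_form i)); last by repeat islin_step.
rewrite -untwist_comulE; apply: eq_sw => u v; rewrite !linearZ /=.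
exact: mulrC.
Qed.

Lemma untwist_coef_span c : exists a : 'I_(dim H) -> 'I_(dim H) -> k,
  c = \sum_i \sum_j a i j *: corep_coef i j.
Proof.
(* These coefficients come from the left counit axiom, with [c] and the first leg of the coproduct
   expanded in the basis. *)
exists (fun i j => v2r c 0 j * hcounit A (coord_basis i)).
rewrite exchange_big {1}(coord_basisE c); apply: eq_bigr => j _.
rewrite -[coord_basis j in LHS]alphaK -(hom_counitl cA) -untwist_comulE.
rewrite untwist_comul_basis sw_sum; try by move=> ?; repeat islin_step.
by rewrite scaler_sumr; apply: eq_bigr => i _; rewrite scalerA.
Qed.

Lemma untwist_comulM i j l m :
  untwist_comul (untwist_mul (corep_coef i j) (corep_coef l m))
  = \sum_e \sum_f untwist_mul (corep_coef i e) (corep_coef l f)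
                    \ox untwist_mul (corep_coef e j) (corep_coef f m).
Proof.
rewrite untwist_comulE /untwist_mul alphaVK.
have E x : hcomul A x = \sw_(u, v <- untwist_comul x) alphaV u \ox alphaV v.
  rewrite untwist_comulE (hom_cotwist_comul cA).
  rewrite (@sw_lin _ _ _ _ _ (fun z => \sw_(u, v <- z) alphaV u \ox alphaV v));
    last by repeat islin_step.
  rewrite [LHS]tensE; apply: eq_sw => u v.
  by rewrite sw_tensor ?alphaK //; move=> ?; repeat islin_step.
have Ec i' j' : hcomul A (corep_coef i' j')
    = \sum_e alphaV (corep_coef i' e) \ox alphaV (corep_coef e j').
  rewrite E untwist_comul_coef sw_sum //; by move=> ?; repeat islin_step.
rewrite (hom_comulM bA) !Ec sw_sum; try by move=> ?; repeat islin_step.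
apply: eq_bigr => e _; rewrite sw_sum; try by move=> ?; repeat islin_step.
by apply: eq_bigr => f _; rewrite !htwist_invM.
Qed.

Lemma untwist_comul1 : untwist_comul (hone A) = hone A \ox hone A.
Proof. by rewrite untwist_comulE (hom_twist1 aA) (hom_comul1 bA). Qed.

Lemma untwist_counitM x y :
  hcounit A (untwist_mul x y) = hcounit A x * hcounit A y :> k.
Proof.
by rewrite -(hom_cotwist_counit cA) /untwist_mul alphaVK (hom_counitM bA).
Qed.

Lemma untwist_antipodel i j :
  \sum_e untwist_mul (hantipode A (corep_coef i e)) (corep_coef e j)
  = (i == j)%:R *: hone A.
Proof.
rewrite -untwist_counit_coef -(hom_cotwist_counit cA) -[hone A]alphaK.
rewrite (hom_twist1 aA) -linearZ -(hom_antipodel sA) -untwist_comulE.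
rewrite untwist_comul_coef sw_sum; try by move=> ?; repeat islin_step.
by rewrite linear_sum.
Qed.

Lemma untwist_antipoder i j :
  \sum_e untwist_mul (corep_coef i e) (hantipode A (corep_coef e j))
  = (i == j)%:R *: hone A.
Proof.
rewrite -untwist_counit_coef -(hom_cotwist_counit cA) -[hone A]alphaK.
rewrite (hom_twist1 aA) -linearZ -(hom_antipoder sA) -untwist_comulE.
rewrite untwist_comul_coef sw_sum; try by move=> ?; repeat islin_step.
by rewrite linear_sum.
Qed.

Definition untwist : hopf H :=
  Hopf untwist_mul_bilinear untwist_mulA untwist_mul1l untwist_mul1r
    untwist_coef_span untwist_comul_coef untwist_counit_coef untwist_comulM
    untwist_comul1 untwist_counitM (hom_counit1 bA)
    untwist_antipodel untwist_antipoder.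

Lemma untwist_auto : hopf_auto untwist alpha.
Proof.
split.
- exact: hom_twist_bij aA.
- move=> x y; apply/esym.
  by rewrite /= /untwist_mul -(hom_twistM aA) alphaK alphaVK.
- exact: hom_twist1 aA.
- exact: untwist_comul_twist.
- exact: hom_cotwist_counit cA.
exact: hom_antipode_twist sA.
Qed.

End Untwist.

(** * The automorphism induced on the double *)

Section DoubleAuto.
Variables (k : fieldType) (H : vectType k) (B : hopf H) (phi : 'End(H)).
Hypothesis phiA : hopf_auto B phi.
Local Notation "x ** y" := (hopf_mul B x y) (at level 40, left associativity).
Local Notation F := (dual_hopf B).
Local Notation psi := (phi^-1)%VF.
Local Notation K := (tens H (dual H)).
Let phiK : cancel phi psi := (bij_lfunK (hopf_auto_bij phiA)).1.
Let psiK : cancel psi phi := (bij_lfunK (hopf_auto_bij phiA)).2.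
Let psiA := hopf_auto_inv phiA.
Let cT := coef_comatrix B.

(** Each clause is the transpose of one for [psi]: product and coproduct trade places, and so do
    unit and counit. *)
Lemma dual_auto : hopf_auto F (dual_precomp psi).
Proof.
split.
- exists (dual_precomp phi) => f; apply/lfunP => a;
    by rewrite !dual_precomp_eval ?phiK ?psiK.
- move=> f g; apply: (@dual_ext _ _ B) => i j; rewrite dual_precomp_eval.
  rewrite (convolution_comatrix _ _ _ _ (comatrix_auto psiA cT)).
  rewrite (convolution_comatrix _ _ _ _ cT).
  by apply: eq_bigr => e _; rewrite !dual_precomp_eval.
- by apply/lfunP => a; rewrite dual_precomp_eval (hopf_auto_counit psiA).
- move=> f; apply: dual_tens_ext => a b.
  rewrite [LHS]dual_hopf_comul_pair dual_precomp_eval (hopf_autoM psiA).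
  rewrite -(dual_hopf_comul_pair B) /dual_pair.
  rewrite (@sw_lin _ _ _ _ k^o
      (fun z => tens_lift (fun f1 f2 : dual H => f1 a * f2 b : k^o) z));
    last by repeat islin_step.
  apply: eq_sw => u v; rewrite sw_tensor; try by move=> ?; repeat islin_step.
  by rewrite !dual_precomp_eval.
- by move=> f; rewrite !dual_hopf_counitE dual_precomp_eval (hopf_auto1 psiA).
move=> f; apply/lfunP => a; rewrite [LHS]dual_hopf_antipodeE !dual_precomp_eval.
by rewrite (hopf_auto_antipode psiA).
Qed.

Definition double_map (g : 'End(H)) (g' : 'End(dual H)) : 'End(K) :=
  linfun (fun t : K => \sw_(h, f <- t) g h \ox g' f).

Lemma double_mapE g g' h f : double_map g g' (h \ox f) = g h \ox g' f.
Proof.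
rewrite linfunE; last by rewrite -/(islin _); repeat islin_step.
by rewrite sw_tensor //; move=> ?; repeat islin_step.
Qed.

Lemma double_mapK (g f : 'End(H)) (g' f' : 'End(dual H)) :
  cancel g f -> cancel g' f' -> cancel (double_map g g') (double_map f f').
Proof.
move=> gK gK'; apply: tens_ext => [||x y]; try by repeat islin_step.
by rewrite !double_mapE gK gK'.
Qed.

Local Notation phid := (dual_precomp psi).
Local Notation phiD := (double_map phi phid).

Lemma coadj_auto f x y :
  phid (coadj B f x y) = coadj B (phid f) (phi x) (phi y).
Proof.
apply/lfunP => a; rewrite dual_precomp_eval !coadjE dual_precomp_eval.
by rewrite !(hopf_autoM psiA) -(hopf_auto_antipode psiA) !phiK.
Qed.

Lemma double_mul_auto s t :
  phiD (double_mul B s t) = double_mul B (phiD s) (phiD t).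
Proof.
move: s; apply: tens_ext => [||h f]; try by repeat islin_double.
move: t; apply: (@double_ext _ _ B) => [||i j g]; try by repeat islin_double.
rewrite !double_mapE (double_mulE _ _ _ _ _ cT).
rewrite (double_mulE _ _ _ _ _ (comatrix_auto phiA cT)).
rewrite linear_sum; apply: eq_bigr => c _; rewrite linear_sum.
apply: eq_bigr => d _; rewrite [LHS]double_mapE (hopf_autoM phiA).
by rewrite (hopf_autoM dual_auto) coadj_auto.
Qed.

Lemma double_auto : hopf_auto (double B) phiD.
Proof.
have [phidK psidK] := bij_lfunK (hopf_auto_bij dual_auto).
split.
- by exists (double_map psi (phid^-1)%VF); apply: double_mapK.
- exact: double_mul_auto.
- rewrite [LHS]double_mapE (hopf_auto1 phiA).
  by rewrite (hopf_auto1 dual_auto : phid (hopf_counit B) = _).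
- apply: tens_ext => [||h f]; try by repeat islin_double.
  rewrite double_mapE [LHS]double_comulE
    [hopf_comul (double B) (h \ox f)]double_comulE.
  rewrite (hopf_auto_comul phiA) (hopf_auto_comul dual_auto).
  rewrite (@sw_lin _ _ _ _ _ (fun z =>
      \sw_(h1, h2 <- z) \sw_(f1, f2 <- _) (h1 \ox f1) \ox (h2 \ox f2)));
    last by repeat islin_double.
  rewrite [RHS](@sw_lin _ _ _ _ _ (fun z => \sw_(x, y <- z) phiD x \ox phiD y));
    last by repeat islin_double.
  apply: eq_sw => u v; rewrite sw_tensor; try by move=> ?; repeat islin_double.
  rewrite (@sw_lin _ _ _ _ _ (fun z =>
      \sw_(f1, f2 <- z) (_ \ox f1) \ox (_ \ox f2)));
    last by repeat islin_double.
  rewrite [RHS](@sw_lin _ _ _ _ _ (fun z => \sw_(x, y <- z) phiD x \ox phiD y));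
    last by repeat islin_double.
  apply: eq_sw => u' v'; rewrite sw_tensor;
    try by move=> ?; repeat islin_double.
  by rewrite sw_tensor ?double_mapE //; move=> ?; repeat islin_double.
- apply: (@tens_ext _ _ _ k^o) => [||h f]; try by repeat islin_double.
  rewrite double_mapE [LHS]double_counitE [RHS]double_counitE.
  by rewrite (hopf_auto_counit phiA) dual_precomp_eval (hopf_auto1 psiA).
apply: tens_ext => [||h f]; try by repeat islin_double.
rewrite double_mapE [LHS]double_antipodeE
    [hopf_antipode (double B) (h \ox f)]double_antipodeE.
rewrite double_mul_auto !double_mapE (hopf_auto1 phiA).
rewrite (hopf_auto_antipode dual_auto).
rewrite (hopf_auto1 dual_auto : phid (hopf_counit B) = _).
(* That [phi] commutes with the inverse antipode is checked after applying the antipode. *)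
congr (double_mul B _ (_ \ox _)); apply: (can_inj (antipodeK B)).
by rewrite (hopf_auto_antipode phiA) !antipode_invK.
Qed.

End DoubleAuto.

(** * From the ordinary double to the stated operations *)

Theorem corollary4p5 (k : fieldType) (H : vectType k) (A : homHopfAlgebra H) :
  exists D : homHopfAlgebra (tens H (dual H)),
  [/\ forall (h : H) (f : dual H),
        htwist D (h \ox f) = htwist A h \ox dual_twist A f,
      hone D = hone A \ox (hcounit A : dual H),
      forall (h : H) (f : dual H),
        hcomul D (h \ox f)
        = \sw_(h1, h2 <- hcomul A h) \sw_(f1, f2 <- dual_comul A f)
             (h1 \ox f1) \ox (h2 \ox f2),
      forall (h : H) (f : dual H),
        hcounit D (h \ox f) = hcounit A h * f (hone A) :> k
    & forall (h x : H) (f g : dual H),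
        (h \ox f) *[D] (x \ox g)
        = \sw_(x1, x2 <- hcomul A x) \sw_(x21, x22 <- hcomul A x2)
             (htwist A (htwist A x21) *[A] h)
               \ox dual_mul A (double_twisted A f x1 x22) g].
Proof.
pose B := untwist A; have phiA := untwist_auto A.
have [aK aVK] := bij_lfunK (hopf_auto_bij phiA).
have mulE x y : x *[A] y = htwist A (hopf_mul B x y) by rewrite [RHS]aVK.
have comulE c : hcomul A c = hopf_comul B ((htwist A)^-1%VF c).
  by rewrite [RHS](untwist_comulE A) aVK.
have phiDA := double_auto phiA.
have cT := coef_comatrix B.
have cT1 := comatrix_auto (hopf_auto_inv phiA) cT.
have cT2 := comatrix_auto (hopf_auto_inv phiA) cT1.
have [dK _] := bij_lfunK (hopf_auto_bij phiDA).
exists (twist phiDA); split=> [h f||h f|h f|h x f g].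
- by rewrite [LHS]double_mapE dual_precompE.
- by [].
(* The twisted coproduct first applies the inverse of the automorphism, so the argument is written
   as an image under it. *)
- have E : h \ox f = double_map (htwist A) (dual_precomp (htwist A)^-1%VF)
     ((htwist A)^-1%VF h \ox dual_precomp (htwist A) f).
    rewrite double_mapE aVK; congr (_ \ox _); apply/lfunP => a.
    by rewrite !dual_precomp_eval aVK.
  rewrite [LHS](twist_comulE (double B)) {1}E dK [LHS]double_comulE comulE.
  suff -> : hopf_comul (dual_hopf B) (dual_precomp (htwist A) f)
            = dual_comul A f by [].
  apply/dual_comulP => a b.
  by rewrite [LHS]dual_hopf_comul_pair dual_precomp_eval -mulE.
- exact: double_counitE.
rewrite [LHS](twist_mulE (double B)).
have mulL (u v : dual H) : dual_mul A u v
    = dual_precomp (htwist A)^-1%VF (hopf_mul (dual_hopf B) u v).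
  apply/lfunP => a; rewrite dual_precomp_eval dual_mulE comulE.
  by rewrite [RHS]convolutionE.
(* Each of the two nested products of [A] contributes one twist. Together they cancel the inverse
   twists on [a], leaving one twist on [u] and two on [v]. *)
have twistedL u v : double_twisted A f u v
    = coadj B f (htwist A u) (htwist A (htwist A v)).
  apply/lfunP => a; rewrite double_twistedE coadjE !mulE.
  rewrite !(hopf_autoM phiA) !aVK.
  by rewrite [hopf_antipode B (htwist A u)](hopf_auto_antipode phiA).
transitivity (\sw_(x1, x2 <- hcomul A x) \sw_(x21, x22 <- hcomul A x2)
    (htwist A (htwist A x21) *[A] h) \ox dual_precomp (htwist A)^-1%VF
      (hopf_mul (dual_hopf B)
        (coadj B f (htwist A x1) (htwist A (htwist A x22))) g)); last first.
  by apply: eq_sw => u v; apply: eq_sw => u' v'; rewrite mulL twistedL.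
(* On coefficients, the first leg of the iterated coproduct of [A] carries one inverse twist and the
   other two legs carry two; the twists in the formula cancel exactly these. *)
move: x; apply: (@coef_ext _ _ B) => [||i j]; try by repeat islin_double.
rewrite [hopf_mul (double B) _ _](double_mulE _ _ _ _ _ cT).
rewrite comulE (sw_comatrix _ _ cT1); try by move=> ?; repeat islin_double.
rewrite linear_sum; apply: eq_bigr => c _.
rewrite comulE (sw_comatrix _ _ cT2); try by move=> ?; repeat islin_double.
rewrite linear_sum; apply: eq_bigr => d _.
by rewrite [LHS]double_mapE mulE !aVK.
Qed.
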